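(* There exists a frequency $\lambda$ satisfying (BC) such that $\sigma_{\mathcal H_1(\lambda)}=2\sigma_{\mathcal H_2(\lambda)}$ and $\sigma_{\mathcal H_2(\lambda)}>0$.
   Context: A frequency is a (strictly) increasing sequence $\lambda=(\lambda_n)_{n\ge1}$ of nonnegative real numbers tending to $+\infty$. A $\lambda$-Dirichlet series is a formal series $D=\sum_{n\ge1} a_n e^{-\lambda_n s}$, $a_n\in\mathbb C$. For $\theta\in\mathbb R$, $\mathbb C_\theta=\{s\in\mathbb C:\mathrm{Re}\,s>\theta\}$. Condition (BC): there exist $\ell>0$ and $C>0$ such that $\lambda_{n+1}-\lambda_n\ge Ce^{-\ell\lambda_n}$ for all $n\in\mathbb N$. Hardy spaces: let $G$ be a compact abelian group (with normalized Haar measure) and $\beta:(\mathbb R,+)\to G$ a continuous homomorphism with dense range. $(G,\beta)$ is a $\lambda$-Dirichlet group if for every $n$ there is $h_{\lambda_n}\in\widehat G$ with $h_{\lambda_n}(\beta(t))=e^{-i\lambda_n t}$ for all $t\in\mathbb R$; such a group always exists. For $p\in[1,+\infty]$, $H_p^\lambda(G)$ is the subspace of $f\in L_p(G)$ with $\widehat f$ supported in $\{h_{\lambda_n}:n\in\mathbb N\}$. $\mathcal H_p(\lambda)$ is the space of all $\lambda$-Dirichlet series $\sum_n\widehat f(h_{\lambda_n})e^{-\lambda_ns}$, $f\in H_p^\lambda(G)$, with norm $\|\sum_n\widehat f(h_{\lambda_n})e^{-\lambda_ns}\|_p=\|f\|_p$; it does not depend on the chosen $\lambda$-Dirichlet group.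 For $p<\infty$ it is equivalently the completion of the $\lambda$-Dirichlet polynomials $D=\sum_{n=1}^Na_ne^{-\lambda_ns}$ under $\|D\|_p^p=\lim_{T\to+\infty}\frac1{2T}\int_{-T}^T|D(it)|^p\,dt$. For a $\lambda$-Dirichlet series $D$, $\sigma_c(D)=\inf\{\sigma\in\mathbb R: D\text{ converges on }\mathbb C_\sigma\}$, and $\sigma_{\mathcal H_p(\lambda)}=\inf\{\sigma\in\mathbb R:\ \sigma_c(D)\le\sigma\text{ for all }D\in\mathcal H_p(\lambda)\}$. *)

(* Defs.v *)
From HB Require Import structures.
From mathcomp Require Import all_boot all_order all_algebra complex.
From mathcomp Require Import all_classical all_reals all_analysis.

Set Implicit Arguments.
Unset Strict Implicit.
Unset Printing Implicit Defensive.
Import Order.TTheory GRing.Theory Num.Theory.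
Import numFieldNormedType.Exports.
Local Open Scope classical_set_scope.
Local Open Scope ring_scope.

(* [R[i]^o] is [R[i]] seen as a normed space over itself, which is the form in
   which it carries its usual topology; norms on [R[i]] take values in [R[i]],
   so [cmod] projects them to [R]. *)
Definition cmod (R : realType) (z : R[i]) : R := complex.Re `|z|.

Definition cexp (R : realType) (z : R[i]) : R[i] :=
  (expR (complex.Re z))%:C%C *
  (cos (complex.Im z) +i* sin (complex.Im z))%C.

(* Sequences are indexed from 0, so that [lam n] is $\lambda_{n+1}$. *)
Definition is_frequency (R : realType) (lam : nat -> R) : Prop :=
  [/\ {homo lam : m n / (m < n)%N >-> m < n},
      forall n, 0 <= lam n
    & lam @ \oo --> +oo].

Definition cond_BC (R : realType) (lam : nat -> R) : Prop :=
  exists l C : R, [/\ 0 < l, 0 < C &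
    forall n, C * expR (- l * lam n) <= lam n.+1 - lam n].

(* Measurable types are required to be pointed, which topological groups are
   not; [borel G] is [G] pointed at 0 and equipped with its Borel sets. *)
Definition pointed_group (G : topologicalZmodType) : Type := G.

HB.instance Definition _ (G : topologicalZmodType) :=
  Topological.on (pointed_group G).
HB.instance Definition _ (G : topologicalZmodType) :=
  isPointed.Build (pointed_group G) (0 : G).

Notation borel G :=
  (g_sigma_algebraType (@open (pointed_group G) : set (set _))).

(* The measure being finite, outer regularity on all Borel sets also gives
   inner regularity by closed, hence compact, sets; without it uniqueness may
   fail on nonmetrizable groups. *)
Definition is_haar (R : realType) (G : topologicalZmodType)
    (mu : probability (borel G) R) : Prop :=
  (forall (x : G) (A : set (borel G)), measurable A ->
     mu [set (x + y : G) | y in (A : set G)] = mu A) /\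
  (forall A : set (borel G), measurable A ->
     mu A = ereal_inf [set mu U | U in [set U : set G | open U /\ A `<=` U]]).

Definition is_character (R : realType) (G : topologicalZmodType)
    (chi : G -> R[i]) : Prop :=
  [/\ continuous (chi : G -> R[i]^o),
      forall x y, chi (x + y) = chi x * chi y
    & forall x, `|chi x| = 1].

Definition cintegral (R : realType) (G : topologicalZmodType)
    (mu : probability (borel G) R) (f : G -> R[i]) : R[i] :=
  (Rintegral mu setT (fun x : borel G => complex.Re (f x)) +i*
   Rintegral mu setT (fun x : borel G => complex.Im (f x)))%C.

Definition fourier (R : realType) (G : topologicalZmodType)
    (mu : probability (borel G) R) (f chi : G -> R[i]) : R[i] :=
  cintegral mu (fun x => f x * (chi x)^*%C).

(* Elements of $L_p$ are given by representatives. *)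
Definition in_Lp (R : realType) (G : topologicalZmodType)
    (mu : probability (borel G) R) (p : \bar R) (f : G -> R[i]) : Prop :=
  [/\ measurable_fun setT (fun x : borel G => complex.Re (f x)),
      measurable_fun setT (fun x : borel G => complex.Im (f x))
    & (Lnorm mu p (fun x : borel G => (cmod (f x))%:E) < +oo)%E].

(* The character $h_{\lambda_n}$; it is unique since [beta] has dense range. *)
Definition is_h (R : realType) (G : topologicalZmodType) (beta : R -> G)
    (x : R) (chi : G -> R[i]) : Prop :=
  is_character chi /\
  forall t : R, chi (beta t) = cexp (- ('i%C * (x * t)%:C%C)).

Definition is_dirichlet_group (R : realType) (lam : nat -> R)
    (G : topologicalZmodType) (beta : R -> G) : Prop :=
  [/\ compact [set: G] /\ hausdorff_space G,
      continuous beta,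
      forall s t : R, beta (s + t) = beta s + beta t,
      dense (range beta)
    & forall n, exists chi, is_h beta (lam n) chi].

Definition in_HpG (R : realType) (lam : nat -> R) (G : topologicalZmodType)
    (beta : R -> G) (mu : probability (borel G) R) (p : \bar R)
    (f : G -> R[i]) : Prop :=
  in_Lp mu p f /\
  forall chi : G -> R[i], is_character chi ->
    (forall n, ~ is_h beta (lam n) chi) -> fourier mu f chi = 0.

(* A Dirichlet series is identified with its sequence of coefficients. The
   space does not depend on the choice of the Dirichlet group, which is
   therefore quantified existentially. *)
Definition Hp (R : realType) (lam : nat -> R) (p : \bar R) :
    set (nat -> R[i]) :=
  [set a | exists (G : topologicalZmodType) (beta : R -> G)
             (mu : probability (borel G) R) (f : G -> R[i]),
     [/\ is_dirichlet_group lam beta, is_haar mu, in_HpG lam beta mu p f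
       & forall n chi, is_h beta (lam n) chi -> a n = fourier mu f chi]].

Definition dirichlet_cvg (R : realType) (lam : nat -> R) (a : nat -> R[i])
    (s : R[i]) : Prop :=
  cvgn (series (fun n => a n * cexp (- ((lam n)%:C%C * s)) : R[i]^o)).

Definition sigma_c (R : realType) (lam : nat -> R) (a : nat -> R[i]) : \bar R :=
  ereal_inf [set theta%:E | theta in
    [set theta : R |
      forall s : R[i], theta < complex.Re s -> dirichlet_cvg lam a s]].

Definition sigma_H (R : realType) (lam : nat -> R) (p : \bar R) : \bar R :=
  ereal_inf [set sigma%:E | sigma in
    [set sigma : R | forall a, Hp lam p a -> (sigma_c lam a <= sigma%:E)%E]].

(* Main.v *)
(* Put $\delta=\sqrt2-1$ and let the frequency consist, for every $k\ge0$, of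
   the block $k+j\delta^k$, $0\le j<2^k$. Since $2\delta<1$ consecutive elements
   are at distance at least $\delta^k$, which is (BC), and
   $\sum_n e^{-\lambda_n x}<\infty$ for $x>\ln2$. As $|a_n|\lesssim\|f\|_1$, this
   gives $\sigma_{\mathcal H_1}\le\ln2$; Bessel's inequality and
   $2uv\le u^2+v^2$ give $\sigma_{\mathcal H_2}\le\ln2/2$.
   Each block is an arithmetic progression, so it carries a Dirichlet kernel $D_k$
   with $\|D_k\|_2=1$ and coefficient sum $2^{k/2}$, and its square, with
   $\|D_k^2\|_1=1$ and coefficient sum $2^k$ (take $D_{k-1}^2$ to stay inside the
   block). The series $\sum_k c_kD_k$, resp. $\sum_k c_kD_{k-1}^2$, with a
   geometric weight $c_k$ shows that both bounds are sharp.
   Because $\delta^2=1-2\delta$, all frequencies lie in $\mathbb Z+\delta\mathbb Z$,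
   so that the two-dimensional torus with the flow $t\mapsto(e^{it},e^{i\delta t})$
   is a Dirichlet group; its Haar measure is the image of the Lebesgue measure on
   $[0,1)^2$. Orthogonality of characters is deduced from translation invariance,
   hence the characters of the torus need not be classified. *)
Require Import Defs.
From HB Require Import structures.
From mathcomp Require Import all_boot all_order all_algebra complex.
From mathcomp Require Import all_classical all_reals all_analysis.
From mathcomp Require Import measurable_realfun ring lra.

Set Implicit Arguments.
Unset Strict Implicit.
Unset Printing Implicit Defensive.
Import Order.TTheory GRing.Theory Num.Theory.
Import numFieldNormedType.Exports.
Local Open Scope classical_set_scope.
Local Open Scope ring_scope.

(** * Absolutely convergent series in L1 *)

(** [Hp] leaves the Dirichlet group free. The upper bounds therefore live on an arbitrary compact
    group and rest on translation invariance alone, whereas the lower bounds may use one convenient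
    group. That group is kept small by the choice of $\delta$. The blocks bring in all powers of
    $\delta$, and these generate a finitely generated subgroup of $\mathbb R$ exactly when $\delta$
    is an algebraic integer. A number in $(0,1/2)$ is not an integer, so degree two is the least
    possible. A ratio such as $1/3$ would lead to a solenoid, a transcendental one to an
    infinite-dimensional torus. A single construction yields the test functions for $p=1$ and $p=2$:
    the series of blocks is summed pointwise off a null set under an integrable majorant. Dominated
    convergence gives its Fourier coefficients, and a weighted Cauchy-Schwarz inequality its
    square-integrability. The abscissa is then tested at real points, where the coefficients are
    nonnegative and partial sums need only be compared at ends of blocks. *)

(** Cauchy-Schwarz for [v k] split into $\sqrt{c_k}$ and $v_k/\sqrt{c_k}$. If [v k ^+ 2] has
    integral at most [c k ^+ 2], the second factor integrates to at most the sum of [c]. *)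
Lemma cauchy_schwarz_series (R : realType) (v c : nat -> R) n :
  (forall k, 0 < c k) ->
  series v n ^+ 2 <= series c n * series (fun k => v k ^+ 2 / c k) n.
Proof.
move=> c0; have pos m : 0 <= series c m /\ 0 <= series (fun k => v k ^+ 2 / c k) m.
  rewrite /series; split; apply: sumr_ge0 => k _ /=; first exact: ltW.
  by rewrite divr_ge0 ?sqr_ge0// ltW.
elim: n => [|n IH]; first by rewrite /series/= !big_geq// mulr0 expr0n.
rewrite !seriesSr; have [] := pos n.
move: IH; set a := series v n; set A := series c n; set B := series _ n.
move: (v n) (c n) (c0 n) => b t t0 IH A0 B0.
(* [A] vanishes only for the empty sum; the case is set apart because the identity below divides by
   [A]. *)
have [A_eq0|A_neq0] := eqVneq A 0.
  have a_eq0 : a = 0.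
    by apply/eqP; rewrite -sqrf_eq0; apply/eqP/le_anti; rewrite sqr_ge0 andbT
      (le_trans IH)// A_eq0 mul0r.
  rewrite a_eq0 A_eq0 !add0r mulrDr mulrCA divff ?gt_eqF// mulr1.
  by rewrite lerDr mulr_ge0// ltW.
have Agt0 : 0 < A by rewrite lt_def A_neq0.
have tB : t * (a ^+ 2 / A) <= t * B.
  by rewrite ler_pM2l// ler_pdivrMr// mulrC.
have sq : 0 <= (A * b / t - a) ^+ 2 * t / A.
  by rewrite divr_ge0// mulr_ge0 ?sqr_ge0// ltW.
(* The terms before [(a + b) ^+ 2] are nonnegative: the induction hypothesis, the same multiplied by
   [t / A], and a square. *)
have -> : (A + t) * (B + b ^+ 2 / t) =
    (A * B - a ^+ 2) + (t * B - t * (a ^+ 2 / A)) + (A * b / t - a) ^+ 2 * t / A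
    + (a + b) ^+ 2.
  by field; rewrite A_neq0 gt_eqF.
by rewrite lerDr; apply: addr_ge0 => //; apply: addr_ge0; rewrite subr_ge0.
Qed.

Section sum_of_integrable_functions.
Context d (T : measurableType d) (R : realType).
Variables (mu : {measure set T -> \bar R}) (v : nat -> T -> R) (c : nat -> R).
Hypothesis mv : forall k, measurable_fun setT (v k).
Hypothesis c0 : forall k, 0 < c k.
Hypothesis cc : cvgn (series c).
Hypothesis vc : forall k, (\int[mu]_x `|v k x|%:E <= (c k)%:E)%E.

Let H x : \bar R := (\sum_(k <oo) `|v k x|%:E)%E.
Let A : set T := [set x | (H x < +oo)%E].
(** The indicator replaces the default value of [limn] at points of divergence by 0. This makes [F]
    a limit of measurable functions everywhere, and the pointwise bounds on [F] hold off [A] as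
    well. *)
Let F x : R := limn (series (v^~ x)) * \1_A x.

Let H_ge0 x : (0 <= H x)%E.
Proof. by apply: nneseries_ge0 => k _ _; rewrite lee_fin. Qed.

Let mabsv k : measurable_fun setT ((fun x => `|v k x|%:E) : T -> \bar R).
Proof. by apply/measurable_EFinP; apply: measurableT_comp. Qed.

Let mH : measurable_fun setT H.
Proof.
apply: (@ge0_emeasurable_sum _ _ _ setT (fun k x => `|v k x|%:E) xpredT).
  by move=> k x _ _; rewrite lee_fin.
by move=> k _; exact: mabsv.
Qed.

Let sum_c_lty : (\sum_(k <oo) (c k)%:E < +oo)%E.
Proof.
have e : (eseries (EFin \o c) = EFin \o series c)%E.
  by apply/funext => n; rewrite /eseries /series/= sumEFin.
have -> : (\sum_(k <oo) (c k)%:E = (limn (series c))%:E)%E.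
  transitivity (limn (EFin \o series c)); first by rewrite -e.
  by apply: cvg_lim => //; apply: cvg_EFin; [exact: nearW|exact: cc].
by rewrite ltry.
Qed.

Let iH : mu.-integrable setT H.
Proof.
apply/integrableP; split => //.
under eq_integral do rewrite gee0_abs//.
rewrite /H integral_nneseries//.
apply: le_lt_trans sum_c_lty; apply: lee_nneseries => //.
by move=> k _ _; apply: integral_ge0.
Qed.

Let mA : measurable A.
Proof.
by rewrite -[A]setTI; exact: (emeasurable_fun_infty_o measurableT mH +oo%E).
Qed.

Let aeA : {ae mu, forall x, A x}.
Proof.
have := integrable_ae measurableT iH; apply: filterS => x /(_ I).
by rewrite ge0_fin_numE.
Qed.

Let cvgF x : A x -> series (v^~ x) n @[n --> \oo] --> F x.
Proof.
move=> Ax; rewrite /F indicE mem_set// mulr1.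
have e : eseries (fun k => `|v k x|%:E) = (EFin \o [normed series (v^~ x)])%E.
  by apply/funext => n; rewrite /eseries /series/= sumEFin.
apply: (normed_cvg (V := R^o)); apply: nondecreasing_is_cvgn.
  by apply: nondecreasing_series => k _ _; exact: normr_ge0.
exists (fine (H x)) => _ [n _ <-]; rewrite -lee_fin fineK ?ge0_fin_numE//.
have -> : ([normed series (v^~ x)] n)%:E = eseries (fun k => `|v k x|%:E) n by rewrite e.
by apply: nneseries_lim_ge => k _ _; rewrite lee_fin.
Qed.

Let mF : measurable_fun setT F.
Proof.
apply/measurable_EFinP; apply: (emeasurable_fun_cvg
  (fun n x => (series (v^~ x) n * \1_A x)%:E)) => [n|x _].
  apply/measurable_EFinP; apply: measurable_funM; last exact: measurable_indic.
  by rewrite /series/=; apply: measurable_sum => k; exact: mv.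
apply: cvg_EFin; first exact: nearW.
have [Ax|nAx] := pselect (A x).
  rewrite -[F x]mulr1 indicE mem_set//.
  by apply: cvgM; [exact: cvgF|exact: cvg_cst].
rewrite /F indicE memNset// mulr0.
by under eq_fun do rewrite mulr0; exact: cvg_cst.
Qed.

(** The bounded multiplier [h] will be the real or imaginary part of a conjugate character, so the
    third clause computes Fourier coefficients of the sum. The last clause handles $p=2$ with the
    same [F]. *)
Lemma integrable_sum_L1 : exists F : T -> R,
  [/\ measurable_fun setT F, mu.-integrable setT (EFin \o F),
    (forall h : T -> R, measurable_fun setT h -> (forall x, `|h x| <= 1) ->
      (\sum_(0 <= k < n) Rintegral mu setT (fun x => v k x * h x)) @[n --> \oo]
         --> Rintegral mu setT (fun x => F x * h x)) &
    (forall k, \int[mu]_x (v k x ^+ 2)%:E <= (c k ^+ 2)%:E)%E ->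
      (\int[mu]_x (F x ^+ 2)%:E < +oo)%E].
Proof.
exists F.
have domv n x : (`|series (v^~ x) n|%:E <= H x)%E.
  apply: le_trans (nneseries_lim_ge n _) => [|k _ _]; last by rewrite lee_fin.
  by rewrite sumEFin lee_fin /series/=; exact: ler_norm_sum.
have mS n : measurable_fun setT (fun x => series (v^~ x) n).
  by rewrite /series/=; apply: measurable_sum => k; exact: mv.
(* [H] is integrable and majorises every partial sum times [h], so dominated convergence covers all
   such [h]; the case [h = 1] gives integrability of [F]. *)
have dom (h : T -> R) : measurable_fun setT h -> (forall x, `|h x| <= 1) ->
  [/\ mu.-integrable setT (fun x => (F x * h x)%:E) &
  (\int[mu]_x (series (v^~ x) n * h x)%:E) @[n --> \oo] -->
      \int[mu]_x (F x * h x)%:E]%E.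
  move=> mh h1.
  have [] := @dominated_convergence _ _ _ mu setT measurableT
    (fun n x => (series (v^~ x) n * h x)%:E) (fun x => (F x * h x)%:E) H.
  - by move=> n; apply/measurable_EFinP; apply: measurable_funM.
  - by apply/measurable_EFinP; apply: measurable_funM.
  - apply: filterS aeA => x Ax _; apply: cvg_EFin; first exact: nearW.
    by apply: cvgM; [exact: cvgF|exact: cvg_cst].
  - exact: iH.
  - apply: aeW => x n _; apply: le_trans (domv n x).
    by rewrite /= lee_fin normrM ler_piMr.
  - by move=> ? _ ?; split.
have iF : mu.-integrable setT (EFin \o F).
  have [|?|+ _] := dom (cst 1); [exact: measurable_cst|by rewrite normr1|].
  by apply: eq_integrable => // x _; rewrite /= mulr1.
have iv k : mu.-integrable setT (EFin \o v k).
  apply/integrableP; split; first exact/measurable_EFinP.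
  by apply: le_lt_trans (vc k) _; rewrite ltry.
split => // [h mh h1|vc2].
  have [iFh cFh] := dom h mh h1.
  have ivh k : mu.-integrable setT (EFin \o (fun x => v k x * h x)).
    apply: le_integrable (iv k) => //.
      by apply/measurable_EFinP; apply: measurable_funM.
    by move=> x _; rewrite /= lee_fin normrM ler_piMr.
  have e n : \sum_(0 <= k < n) Rintegral mu setT (fun x => v k x * h x) =
      fine (\int[mu]_x (series (v^~ x) n * h x)%:E)%E.
    elim: n => [|n IH].
      rewrite big_geq//; under eq_integral do rewrite /series/= big_geq// mul0r.
      by rewrite integral0.
    rewrite big_nat_recr//= IH -[fine _]/(Rintegral _ _ _) -RintegralD//.
      by apply: eq_Rintegral => x _; rewrite seriesSr mulrDl.
    apply: le_integrable iH => //.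
      by apply/measurable_EFinP; apply: measurable_funM.
    move=> x _; rewrite [leRHS]gee0_abs//; apply: le_trans (domv n x).
    by rewrite /= lee_fin normrM ler_piMr.
  under eq_fun do rewrite e.
  apply: fine_cvg; rewrite fineK//; first exact: integrable_fin_num.
pose C := limn (series c).
pose W x := (\sum_(k <oo) (v k x ^+ 2 / c k)%:E)%E.
have cC n : series c n <= C.
  apply: nondecreasing_cvgn_le => //.
  by apply: nondecreasing_series => k _ _; exact/ltW.
have C0 : 0 <= C by apply: le_trans (cC 0%N); rewrite /series/= big_geq.
have vc0 k x : (0 <= (v k x ^+ 2 / c k)%:E)%E.
  by rewrite lee_fin divr_ge0 ?sqr_ge0// ltW.
have mvc k : measurable_fun setT (EFin \o (fun x => v k x ^+ 2 / c k)).
  apply/measurable_EFinP; apply: measurable_funM; last exact: measurable_cst.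
  exact: measurable_funX.
have W0 x : (0 <= W x)%E by apply: nneseries_ge0.
have mW : measurable_fun setT W.
  apply: (@ge0_emeasurable_sum _ _ _ setT
    (fun k x => (v k x ^+ 2 / c k)%:E) xpredT) => [k x _ _|k _].
    exact: vc0.
  exact: mvc.
(* On [A], the finite Cauchy-Schwarz inequality passes to the limit after each factor is bounded by
   its full sum, possibly infinite for [W]. *)
have FW x : ((F x ^+ 2)%:E <= C%:E * W x)%E.
  have [Ax|nAx] := pselect (A x); last first.
    by rewrite /F indicE memNset// mulr0 expr0n/= mule_ge0.
  have SW n : ((series (v^~ x) n ^+ 2)%:E <= C%:E * W x)%E.
    apply: (@le_trans _ _ (series c n * series (fun k => v k x ^+ 2 / c k) n)%:E).
      by rewrite lee_fin; exact: cauchy_schwarz_series.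
    rewrite EFinM; apply: lee_pmul => //.
    - by rewrite lee_fin; apply: sumr_ge0 => k _; exact/ltW.
    - by rewrite lee_fin; apply: sumr_ge0 => k _; rewrite -lee_fin.
    - by rewrite lee_fin.
    - by rewrite /series -sumEFin; apply: nneseries_lim_ge.
  move: SW; case: (C%:E * W x)%E => [r SW| _ |/(_ 0%N)//]; last by rewrite leey.
  rewrite lee_fin; have c2 := cvgM (cvgF Ax) (cvgF Ax).
  rewrite expr2; apply: (cvgr_to_le (c2 _)).
  by apply: nearW => n; rewrite /= -expr2 -lee_fin.
apply: (@le_lt_trans _ _ (\int[mu]_x (C%:E * W x))%E).
  apply: ge0_le_integral => //.
  - by move=> x _; rewrite lee_fin sqr_ge0.
  - by apply/measurable_EFinP; exact: measurable_funX.
  - exact: measurable_funeM.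
rewrite ge0_integralZl//.
rewrite /W integral_nneseries//; apply: lte_mul_pinfty => //.
apply: le_lt_trans sum_c_lty; apply: lee_nneseries => [k _ _|k _].
  by apply: integral_ge0.
(* The integral of [v k ^+ 2 / c k] is at most [c k ^+ 2 / c k = c k], which is summable. *)
under eq_integral do rewrite mulrC EFinM.
rewrite ge0_integralZl//; last first.
- by rewrite lee_fin invr_ge0 ltW.
- by move=> x _; rewrite lee_fin sqr_ge0.
- by apply/measurable_EFinP; exact: measurable_funX.
apply: (@le_trans _ _ ((c k)^-1%:E * (c k ^+ 2)%:E)%E).
  by apply: lee_wpmul2l => //; rewrite lee_fin invr_ge0 ltW.
by rewrite -EFinM lee_fin expr2 mulKf// gt_eqF.
Qed.

End sum_of_integrable_functions.

(** * Complex-valued functions and their integrals *)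

Section complex_numbers.
Variable R : realType.
Implicit Types (z w : R[i]) (x y : R).

Lemma cmodE z : cmod z = Num.sqrt (complex.Re z ^+ 2 + complex.Im z ^+ 2).
Proof. by rewrite /cmod normc_def. Qed.

Lemma normC_cmod z : `|z| = (cmod z)%:C%C.
Proof. by rewrite cmodE normc_def. Qed.

Lemma cmod_ge0 z : 0 <= cmod z.
Proof. by rewrite cmodE sqrtr_ge0. Qed.

Lemma sqr_cmod z : cmod z ^+ 2 = complex.Re z ^+ 2 + complex.Im z ^+ 2.
Proof. by rewrite cmodE sqr_sqrtr// addr_ge0 ?sqr_ge0. Qed.

Lemma cmodM z w : cmod (z * w) = cmod z * cmod w.
Proof. by apply: complexI; rewrite -normC_cmod normrM !normC_cmod rmorphM. Qed.

Lemma cmodJ z : cmod (z^*)%C = cmod z.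
Proof. by rewrite !cmodE; case: z => a b /=; rewrite sqrrN. Qed.

Lemma cmod_real x : cmod x%:C%C = `|x|.
Proof. by rewrite cmodE/= expr0n addr0 sqrtr_sqr. Qed.

Lemma Re_le_cmod z : `|complex.Re z| <= cmod z.
Proof. by rewrite cmodE -sqrtr_sqr ler_wsqrtr// lerDl sqr_ge0. Qed.

Lemma Im_le_cmod z : `|complex.Im z| <= cmod z.
Proof. by rewrite cmodE -sqrtr_sqr ler_wsqrtr// lerDr sqr_ge0. Qed.

Lemma cmod_le_ReIm z : cmod z <= `|complex.Re z| + `|complex.Im z|.
Proof.
have p : 0 <= `|complex.Re z| + `|complex.Im z| by rewrite addr_ge0.
rewrite -(@ler_pXn2r _ 2)// ?nnegrE ?cmod_ge0// sqr_cmod sqrrD !real_normK ?num_real//.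
by rewrite lerD2r lerDl mulrn_wge0// mulr_ge0.
Qed.

Lemma cReM z w : complex.Re (z * w) =
  complex.Re z * complex.Re w - complex.Im z * complex.Im w.
Proof. by case: z w => [a b] [c d]. Qed.

Lemma cImM z w : complex.Im (z * w) =
  complex.Re z * complex.Im w + complex.Im z * complex.Re w.
Proof. by case: z w => [a b] [c d]. Qed.

Lemma cReZ x z : complex.Re (x%:C%C * z) = x * complex.Re z.
Proof. by rewrite cReM/= mul0r subr0. Qed.

Lemma cImZ x z : complex.Im (x%:C%C * z) = x * complex.Im z.
Proof. by rewrite cImM/= mul0r addr0. Qed.

Lemma cReJ z : complex.Re (z^*)%C = complex.Re z.
Proof. by case: z. Qed.

Lemma cImJ z : complex.Im (z^*)%C = - complex.Im z.
Proof. by case: z. Qed.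

Lemma cReD z w : complex.Re (z + w) = complex.Re z + complex.Re w.
Proof. by case: z w => [a b] [c d]. Qed.

Lemma cImD z w : complex.Im (z + w) = complex.Im z + complex.Im w.
Proof. by case: z w => [a b] [c d]. Qed.

Lemma Re_sum (I : Type) (r : seq I) (P : pred I) (F : I -> R[i]) :
  complex.Re (\sum_(i <- r | P i) F i) = \sum_(i <- r | P i) complex.Re (F i).
Proof. exact: (big_morph _ cReD). Qed.

Lemma Im_sum (I : Type) (r : seq I) (P : pred I) (F : I -> R[i]) :
  complex.Im (\sum_(i <- r | P i) F i) = \sum_(i <- r | P i) complex.Im (F i).
Proof. exact: (big_morph _ cImD). Qed.

Lemma complex_eq z w : complex.Re z = complex.Re w ->
  complex.Im z = complex.Im w -> z = w.
Proof. by case: z w => [a b] [c d] /= -> ->. Qed.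

Lemma cexpD z w : cexp (z + w) = cexp z * cexp w.
Proof.
rewrite /cexp cReD cImD expRD cosD sinD.
by apply: complex_eq; rewrite !(cReM, cImM)/=; ring.
Qed.

Lemma cmod_cexp z : cmod (cexp z) = expR (complex.Re z).
Proof.
rewrite /cexp cmodM cmod_real ger0_norm ?expR_ge0// cmodE/= cos2Dsin2.
by rewrite sqrtr1 mulr1.
Qed.

Lemma cexp_real x : cexp x%:C%C = (expR x)%:C%C.
Proof. by apply: complex_eq; rewrite /cexp !(cReM, cImM)/= cos0 sin0; ring. Qed.

Lemma cexp_imag x : cexp (- ('i%C * x%:C%C)) = (cos x -i* sin x)%C.
Proof.
have e : (- ('i%C * x%:C%C) = 0 -i* x :> R[i])%C.
  by apply: complex_eq; rewrite /=; ring.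
by rewrite e /cexp/= expR0 mul1r cosN sinN.
Qed.

Lemma cvg_complexP (T : Type) (F : set_system T) (FF : Filter F)
    (f : T -> R[i]) (l : R[i]) :
  ((f : T -> R[i]^o) @ F --> (l : R[i]^o)) <->
  (complex.Re (f x) @[x --> F] --> complex.Re l /\
   complex.Im (f x) @[x --> F] --> complex.Im l).
Proof.
split=> [/cvgrPdist_lt fl|[/cvgrPdist_lt fr /cvgrPdist_lt fi]].
  split; apply/cvgrPdist_lt => e e0;
    (have /fl : 0 < (e%:C%C : R[i]) by rewrite ltcR);
    apply: filterS => x; rewrite normC_cmod ltcR; apply: le_lt_trans.
    by apply: le_trans (Re_le_cmod _); rewrite cReD; case: (f x).
  by apply: le_trans (Im_le_cmod _); rewrite cImD; case: (f x).
(* Positivity in [R[i]] includes the vanishing of the imaginary part, so the radius is a real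
   number. *)
apply/cvgrPdist_lt => -[e e']; rewrite ltcE/= => /andP[/eqP -> e0].
have e2 : 0 < e / 2 by rewrite divr_gt0.
near=> x; rewrite normC_cmod ltcR.
have -> : e = e / 2 + e / 2 by rewrite -splitr.
apply: le_lt_trans (cmod_le_ReIm _) _; rewrite cReD cImD.
have -> : complex.Re (- f x) = - complex.Re (f x) by case: (f x).
have -> : complex.Im (- f x) = - complex.Im (f x) by case: (f x).
by apply: ltrD; near: x; [exact: fr|exact: fi].
Unshelve. all: by end_near. Qed.

Lemma continuous_complexP (T : topologicalType) (f : T -> R[i]) :
  continuous (f : T -> R[i]^o) <->
  (continuous (fun x : T => complex.Re (f x)) /\
   continuous (fun x : T => complex.Im (f x))).
Proof.
split=> [cf|[cr ci] x]; last first.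
  by apply/cvg_complexP; split; [exact: cr|exact: ci].
by split=> x; have /cvg_complexP[] := cf x.
Qed.

End complex_numbers.

Section complex_integral.
Context d (T : measurableType d) (R : realType).
Variable mu : probability T R.
Implicit Types (f g : T -> R[i]).

Definition cmeasurable f :=
  measurable_fun setT (fun x => complex.Re (f x)) /\
  measurable_fun setT (fun x => complex.Im (f x)).

Definition cintegrable f :=
  mu.-integrable setT (EFin \o (fun x => complex.Re (f x))) /\
  mu.-integrable setT (EFin \o (fun x => complex.Im (f x))).

(** On [borel G] this is convertible to [cintegral], and later proofs pass silently between the
    two. *)
Definition cint f : R[i] :=
  (Rintegral mu setT (fun x => complex.Re (f x)) +i*
   Rintegral mu setT (fun x => complex.Im (f x)))%C.

Lemma measurable_cmod f : cmeasurable f ->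
  measurable_fun setT (fun x => cmod (f x)).
Proof.
move=> [mr mi]; under eq_fun do rewrite cmodE.
apply: (@measurableT_comp _ _ _ _ _ _ (@Num.sqrt R)).
  by apply: continuous_measurable_fun; exact: sqrt_continuous.
by apply: measurable_funD; exact: measurable_funX.
Qed.

Lemma cmeasurableM f g : cmeasurable f -> cmeasurable g ->
  cmeasurable (fun x => f x * g x).
Proof.
move=> [fr fi] [gr gi]; split.
  under eq_fun do rewrite cReM.
  by apply: measurable_funB; exact: measurable_funM.
under eq_fun do rewrite cImM.
by apply: measurable_funD; exact: measurable_funM.
Qed.

Lemma cintegrableP f : cmeasurable f ->
  (\int[mu]_x (cmod (f x))%:E < +oo)%E -> cintegrable f.
Proof.
move=> mf foo.
have im : mu.-integrable setT (EFin \o (fun x => cmod (f x))).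
  apply/integrableP; split; first exact/measurable_EFinP/measurable_cmod.
  by under eq_integral do rewrite /= ger0_norm ?cmod_ge0//.
have [mr mi] := mf; split; apply: le_integrable im => //;
  do ?exact/measurable_EFinP; move=> x _;
  rewrite /= lee_fin [leRHS]ger0_norm ?cmod_ge0//.
  exact: Re_le_cmod.
exact: Im_le_cmod.
Qed.

Lemma cintegrable_bounded f (M : R) : cmeasurable f ->
  (forall x, cmod (f x) <= M) -> cintegrable f.
Proof.
move=> mf fM; apply: cintegrableP => //.
apply: (@le_lt_trans _ _ (\int[mu]_(x in [set: T]) M%:E)%E); last first.
  rewrite integral_cst//= (_ : mu setT = 1%E) ?mule1 ?ltry//.
  exact: probability_setT.
apply: ge0_le_integral => //.
- by move=> x _; rewrite lee_fin cmod_ge0.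
- exact/measurable_EFinP/measurable_cmod.
- by move=> x _; rewrite lee_fin.
Qed.

Lemma cintegrable_cmeasurable f : cintegrable f -> cmeasurable f.
Proof. by move=> [fr fi]; split; apply/measurable_EFinP; exact: (measurable_int mu). Qed.

Lemma cintegrableM f g : cintegrable f -> cmeasurable g ->
  (forall x, cmod (g x) <= 1) -> cintegrable (fun x => f x * g x).
Proof.
move=> If mg g1; have mf := cintegrable_cmeasurable If.
have [fr fi] := If; apply: cintegrableP; first exact: cmeasurableM.
have is_ : mu.-integrable setT (fun x =>
    (`|complex.Re (f x)|%:E + `|complex.Im (f x)|%:E)%E).
  by apply: integrableD => //; [exact: (integrable_abse fr)|exact: (integrable_abse fi)].
have /integrableP[_] := is_; apply: le_lt_trans; apply: ge0_le_integral => //.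
- by move=> x _; rewrite lee_fin cmod_ge0.
- exact/measurable_EFinP/measurable_cmod/cmeasurableM.
- by apply: measurableT_comp => //; exact: measurable_int is_.
- move=> x _; rewrite -EFinD /= lee_fin ger0_norm ?addr_ge0// cmodM.
  by rewrite (le_trans _ (cmod_le_ReIm _))// ler_piMr ?cmod_ge0.
Qed.

Lemma cintegralD f g : cintegrable f -> cintegrable g ->
  cintegrable (fun x => f x + g x) /\
  cint (fun x => f x + g x) = cint f + cint g.
Proof.
move=> [fr fi] [gr gi].
have e1 : (fun x => complex.Re (f x + g x)) =
    (fun x => complex.Re (f x) + complex.Re (g x)).
  by apply/funext => x; rewrite cReD.
have e2 : (fun x => complex.Im (f x + g x)) =
    (fun x => complex.Im (f x) + complex.Im (g x)).
  by apply/funext => x; rewrite cImD.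
split.
  split; rewrite ?e1 ?e2.
    by have := integrableD measurableT fr gr.
  by have := integrableD measurableT fi gi.
by apply: complex_eq; rewrite /cint/= ?e1 ?e2 RintegralD.
Qed.

Lemma cintegralZ f (c : R[i]) : cintegrable f ->
  cintegrable (fun x => c * f x) /\
  cint (fun x => c * f x) = c * cint f.
Proof.
move=> [fr fi].
have e1 : (fun x => complex.Re (c * f x)) =
    (fun x => complex.Re c * complex.Re (f x) - complex.Im c * complex.Im (f x)).
  by apply/funext => x; rewrite cReM.
have e2 : (fun x => complex.Im (c * f x)) =
    (fun x => complex.Re c * complex.Im (f x) + complex.Im c * complex.Re (f x)).
  by apply/funext => x; rewrite cImM.
have iz (r : R) (h : T -> R) : mu.-integrable setT (EFin \o h) ->
    mu.-integrable setT (EFin \o (fun x => r * h x)).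
  by move=> ih; have := integrableZl measurableT r ih.
split.
  split; rewrite ?e1 ?e2.
    by have := integrableB measurableT (iz (complex.Re c) _ fr) (iz (complex.Im c) _ fi).
  by have := integrableD measurableT (iz (complex.Re c) _ fi) (iz (complex.Im c) _ fr).
apply: complex_eq; rewrite /cint/= ?e1 ?e2 ?cReM ?cImM.
  by rewrite RintegralB ?RintegralZl//; exact: iz.
by rewrite RintegralD ?RintegralZl//; exact: iz.
Qed.

Lemma cintegral_sum (F : nat -> T -> R[i]) n : (forall k, cintegrable (F k)) ->
  cintegrable (fun x => \sum_(0 <= k < n) F k x) /\
  cint (fun x => \sum_(0 <= k < n) F k x) =
    \sum_(0 <= k < n) cint (F k).
Proof.
move=> IF; elim: n => [|n [IH1 IH2]].
  have -> : (fun x => \sum_(0 <= k < 0) F k x) = cst 0.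
    by apply/funext => x; rewrite big_geq.
  rewrite big_geq//; split.
    apply: (@cintegrable_bounded _ 0).
      by split; exact: measurable_cst.
    by move=> x; rewrite /cst cmodE expr0n/= addr0 sqrtr0.
  by apply: complex_eq; rewrite /cint/= Rintegral_cst// mul0r.
have -> : (fun x => \sum_(0 <= k < n.+1) F k x) =
    (fun x => \sum_(0 <= k < n) F k x + F n x).
  by apply/funext => x; rewrite big_nat_recr.
by rewrite big_nat_recr//= -IH2; exact: cintegralD.
Qed.

(** Real and imaginary parts are bounded separately. The resulting factor 2 on the modulus is
    harmless, as only boundedness of the coefficients matters. *)
Lemma cintegral_bound f (K : R) : cmeasurable f ->
  (\int[mu]_x (cmod (f x))%:E <= K%:E)%E ->
  `|complex.Re (cint f)| <= K /\ `|complex.Im (cint f)| <= K.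
Proof.
move=> mf fK; have [fr fi] := cintegrableP mf (le_lt_trans fK (ltry _)).
split; rewrite /cint/= -lee_fin; rewrite EFin_normr_Rintegral//;
  (apply: le_trans (le_abse_integral _ _ _) _ => //; first exact: (measurable_int mu));
  apply: le_trans fK; apply: ge0_le_integral => //.
- by apply: measurableT_comp => //; exact: measurable_int fr.
- exact/measurable_EFinP/measurable_cmod.
- by move=> x _; rewrite /= lee_fin Re_le_cmod.
- by apply: measurableT_comp => //; exact: measurable_int fi.
- exact/measurable_EFinP/measurable_cmod.
- by move=> x _; rewrite /= lee_fin Im_le_cmod.
Qed.

End complex_integral.

Section borel_functions.
Variables (R : realType) (G : topologicalZmodType).
Variable mu : probability (borel G) R.
Implicit Types (f : G -> R[i]).

Lemma borel_continuous (g : G -> R) :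
  continuous g -> measurable_fun setT (g : borel G -> R).
Proof.
move=> /continuousP cg; apply: (measurability _ (RGenOpens.measurableE R)).
move=> _ [_ [a [b ->] <-]]; rewrite setTI; apply: sub_sigma_algebra.
exact/cg/interval_open.
Qed.

Lemma continuous_cmeasurable f :
  continuous (f : G -> R[i]^o) -> cmeasurable (f : borel G -> R[i]).
Proof.
by move=> /continuous_complexP[? ?]; split; exact: borel_continuous.
Qed.

Lemma in_Lp1P f : in_Lp mu 1%:E f <->
  cmeasurable (f : borel G -> R[i]) /\ (\int[mu]_x (cmod (f (x : borel G)))%:E < +oo)%E.
Proof.
rewrite /in_Lp Lnorm1.
have -> : (\int[mu]_x `|(cmod (f (x : borel G)))%:E| =
   \int[mu]_x (cmod (f (x : borel G)))%:E)%E.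
  by apply: eq_integral => x _; rewrite /= ger0_norm ?cmod_ge0.
by split=> [[]|[[]]].
Qed.

Lemma in_Lp2P f : in_Lp mu 2%:E f <->
  cmeasurable (f : borel G -> R[i]) /\ (\int[mu]_x (cmod (f (x : borel G)) ^+ 2)%:E < +oo)%E.
Proof.
have e : (\int[mu]_x (cmod (f (x : borel G)) ^+ 2)%:E =
   \int[mu]_x (`|(cmod (f (x : borel G)))%:E| `^ 2))%E.
  apply: eq_integral => x _; rewrite /= ger0_norm ?cmod_ge0//.
  by rewrite powR_mulrn ?cmod_ge0.
rewrite /in_Lp e; split=> [[mr mi foo]|[[mr mi] foo]]; split => //.
  by rewrite -powR_Lnorm// poweR_lty.
by rewrite Lnorm.unlock; exact: poweR_lty.
Qed.

End borel_functions.

(** * Characters and Bessel's inequality *)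

Section characters.
Variables (R : realType) (G : topologicalZmodType).
Implicit Types chi psi : G -> R[i].

Lemma cmod_character chi x : is_character chi -> cmod (chi x) = 1.
Proof. by move=> [_ _ /(_ x) h]; rewrite /cmod h. Qed.

Lemma character_continuous chi :
  is_character chi -> continuous (chi : G -> R[i]^o).
Proof. by case. Qed.

Lemma characterJ chi : is_character chi -> is_character (fun x => (chi x)^*%C).
Proof.
move=> hc; have [cchi chiD _] := hc; split.
- have /continuous_complexP[cr ci] := cchi.
  apply/continuous_complexP; split.
    by under eq_fun do rewrite cReJ.
  under eq_fun do rewrite cImJ.
  by move=> x; apply: cvgN; exact: ci.
- by move=> x y; rewrite chiD rmorphM.
- by move=> x; rewrite normC_cmod cmodJ cmod_character.
Qed.

Lemma characterM chi psi : is_character chi -> is_character psi ->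
  is_character (fun x => chi x * psi x).
Proof.
move=> hc hp; have [cchi chiD _] := hc; have [cpsi psiD _] := hp; split.
- have /continuous_complexP[cr ci] := cchi.
  have /continuous_complexP[pr pi] := cpsi.
  apply/continuous_complexP; split => x.
    under eq_fun do rewrite cReM.
    by apply: cvgB; apply: cvgM; [exact: cr|exact: pr|exact: ci|exact: pi].
  under eq_fun do rewrite cImM.
  by apply: cvgD; apply: cvgM; [exact: cr|exact: pi|exact: ci|exact: pr].
- by move=> x y; rewrite chiD psiD mulrACA.
- by move=> x; rewrite normC_cmod cmodM !cmod_character// mulr1.
Qed.

Lemma character1 : is_character (fun _ : G => 1 : R[i]).
Proof.
split; first by move=> x; exact: cvg_cst.
  by move=> x y; rewrite mulr1.
by move=> x; rewrite normr1.
Qed.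

Lemma characterX chi n : is_character chi -> is_character (fun x => chi x ^+ n).
Proof.
move=> hc; elim: n => [|n IH].
  by under eq_fun do rewrite expr0; exact: character1.
by under eq_fun do rewrite exprS; exact: characterM.
Qed.

Lemma mul_conj_character chi x : is_character chi -> chi x * (chi x)^*%C = 1.
Proof. by move=> hc; rewrite -sqr_normc normC_cmod cmod_character// expr1n. Qed.

End characters.

Section haar_measure.
Variables (R : realType) (G : topologicalZmodType).
Variable mu : probability (borel G) R.
Hypothesis hmu : is_haar mu.
Implicit Types (f g chi psi : G -> R[i]).

Lemma translation_continuous (x0 : G) : continuous (fun y : G => x0 + y).
Proof.
move=> y; apply: (@continuous_comp _ _ _ (fun y : G => (x0, y))
  (fun z : G * G => z.1 + z.2)); last exact: add_continuous.
by apply: cvg_pair => /=; [exact: cvg_cst|exact: cvg_id].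
Qed.

Let shift (x0 : G) : borel G -> borel G := fun y : G => x0 + y.

Let measurable_shift x0 : measurable_fun setT (shift x0).
Proof.
apply: (@measurability _ _ _ _ setT (shift x0) open) => //.
move=> _ [B oB <-]; rewrite setTI; apply: sub_sigma_algebra.
have /continuousP := @translation_continuous x0; exact.
Qed.

(** The preimage of a set under translation by [x0] is its translate by [- x0]; hence the image of
    [mu] under the translation is [mu], and a change of variables concludes. *)
Lemma haar_Rintegral (x0 : G) (g : G -> R) :
  measurable_fun setT (g : borel G -> R) ->
  mu.-integrable setT (EFin \o (fun y : borel G => g (x0 + (y : G)))) ->
  Rintegral mu setT (fun y : borel G => g (x0 + (y : G))) =
  Rintegral mu setT (g : borel G -> R).
Proof.
move=> mg ig; congr fine; apply/esym.
transitivity (\int[pushforward mu (shift x0)]_y (g (y : G))%:E)%E.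
  apply: eq_measure_integral => A mA _.
  rewrite -[LHS](hmu.1 (- x0) A mA); congr (mu _).
  apply/seteqP; split => [y [a Aa <-]|y Ay] /=.
    by rewrite /shift addNKr.
  by exists (x0 + y : G); rewrite ?addKr.
by rewrite integral_pushforward//; exact/measurable_EFinP.
Qed.

Lemma cintegrable_character chi :
  is_character chi -> cintegrable mu (chi : borel G -> R[i]).
Proof.
move=> hc; apply: (@cintegrable_bounded _ _ _ _ _ 1).
  exact/continuous_cmeasurable/character_continuous.
by move=> x; rewrite cmod_character.
Qed.

(** Translating the variable by [x0] multiplies the integral by [chi x0] and, by invariance, does
    not change it. *)
Lemma cintegral_character chi x0 : is_character chi -> chi x0 != 1 ->
  cintegral mu chi = 0.
Proof.
move=> hc cx0; have ic := cintegrable_character hc.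
have [mr mi] := cintegrable_cmeasurable ic.
have [ic0 e] := cintegralZ (chi x0) ic.
have e' : (fun x : borel G => chi x0 * chi x) = (fun x => chi (x0 + (x : G))).
  by apply/funext => x; have [_ ->] := hc.
have /eqP : chi x0 * cintegral mu chi = cintegral mu chi.
  rewrite -[LHS]e e'; rewrite e' in ic0; have [i1 i2] := ic0.
  by rewrite /cintegral -(haar_Rintegral mr i1) -(haar_Rintegral mi i2).
rewrite -subr_eq0 -{2}[cintegral mu chi]mul1r -mulrBl mulf_eq0 subr_eq0.
by rewrite (negbTE cx0) => /eqP.
Qed.

(** If the two differ at [x0], then [chi] times the conjugate of [psi] is a character whose value at
    [x0] is not 1, so its integral vanishes. *)
Lemma fourier_character chi psi : is_character chi -> is_character psi ->
  fourier mu chi psi = (`[< chi = psi >])%:R.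
Proof.
move=> hc hp; case: asboolP => [->|ne]; rewrite /fourier.
  have -> : (fun x => psi x * (psi x)^*%C) = cst 1.
    by apply/funext => x; exact: mul_conj_character.
  rewrite /cintegral/= !Rintegral_cst//.
  have -> : fine (mu setT) = 1 by rewrite (_ : mu setT = 1%E)//; exact: probability_setT.
  by rewrite mul0r mul1r.
have [x0 nex0] : exists x0, chi x0 <> psi x0.
  by apply/existsNP => h; apply: ne; exact/funext.
apply: (@cintegral_character _ x0); first exact: characterM (characterJ _).
apply/eqP => h; apply: nex0.
have := congr1 (fun z => z * psi x0) h; rewrite mul1r -mulrA [_^*%C * _]mulrC.
by rewrite mul_conj_character// mulr1.
Qed.

Lemma fourier_sum (F : nat -> G -> R[i]) n psi : is_character psi ->
  (forall k, cintegrable mu (F k : borel G -> R[i])) ->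
  fourier mu (fun x => \sum_(0 <= k < n) F k x) psi =
  \sum_(0 <= k < n) fourier mu (F k) psi.
Proof.
move=> hp IF; rewrite /fourier.
have IFp k : cintegrable mu (fun x : borel G => F k x * (psi x)^*%C).
  apply: cintegrableM => //.
    exact/continuous_cmeasurable/character_continuous/characterJ.
  by move=> x; rewrite cmodJ cmod_character.
have [_ <-] := cintegral_sum n IFp; congr cintegral.
by apply/funext => x; rewrite mulr_suml.
Qed.

Lemma fourier_scale f c psi : is_character psi ->
  cintegrable mu (f : borel G -> R[i]) ->
  fourier mu (fun x => c * f x) psi = c * fourier mu f psi.
Proof.
move=> hp If; rewrite /fourier.
have Ifp : cintegrable mu (fun x : borel G => f x * (psi x)^*%C).
  apply: cintegrableM => //.
    exact/continuous_cmeasurable/character_continuous/characterJ.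
  by move=> x; rewrite cmodJ cmod_character.
have [_ <-] := cintegralZ c Ifp; congr cintegral.
by apply/funext => x; rewrite mulrA.
Qed.

Lemma fourier_trig_poly (chi : nat -> G -> R[i]) (a : nat -> R[i]) n psi :
  is_character psi -> (forall k, is_character (chi k)) ->
  fourier mu (fun x => \sum_(0 <= k < n) a k * chi k x) psi =
  \sum_(0 <= k < n) a k * (`[< chi k = psi >])%:R.
Proof.
move=> hp hc; rewrite fourier_sum//; last first.
  by move=> k; have [] := cintegralZ (a k) (cintegrable_character (hc k)).
apply: eq_bigr => k _; rewrite fourier_scale ?fourier_character//.
exact: cintegrable_character.
Qed.

(** Serves both for Parseval, with [f] the polynomial itself, and for the cross term in Bessel's
    inequality. *)
Lemma cint_mul_trig_poly f (chi : nat -> G -> R[i]) (a : nat -> R[i]) n :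
  cintegrable mu (f : borel G -> R[i]) -> (forall k, is_character (chi k)) ->
  cintegrable mu (fun x : borel G => f x * (\sum_(0 <= k < n) a k * chi k x)^*%C) /\
  cintegral mu (fun x => f x * (\sum_(0 <= k < n) a k * chi k x)^*%C) =
  \sum_(0 <= k < n) (a k)^*%C * fourier mu f (chi k).
Proof.
move=> If hc.
have Ifc k : cintegrable mu (fun x : borel G => f x * (chi k x)^*%C).
  apply: cintegrableM => //.
    exact/continuous_cmeasurable/character_continuous/characterJ.
  by move=> x; rewrite cmodJ cmod_character.
have Ifac k := cintegralZ (a k)^*%C (Ifc k).
have [I1 I2] := cintegral_sum n (fun k => (Ifac k).1).
have e : (fun x : borel G => \sum_(0 <= k < n) (a k)^*%C * (f x * (chi k x)^*%C)) =
    (fun x => f x * (\sum_(0 <= k < n) a k * chi k x)^*%C).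
  apply/funext => x; rewrite rmorph_sum mulr_sumr; apply: eq_bigr => k _.
  by rewrite rmorphM mulrCA.
rewrite e in I1 I2; split => //; rewrite [LHS]I2; apply: eq_bigr => k _.
exact: (Ifac k).2.
Qed.

Lemma sqr_cmodC (z : R[i]) : z * z^*%C = (cmod z ^+ 2)%:C%C.
Proof. by rewrite -sqr_normc normC_cmod rmorphXn. Qed.

Lemma cintegral_sqr_trig_poly (chi : nat -> G -> R[i]) (a : nat -> R[i]) n :
  (forall k, is_character (chi k)) -> injective chi ->
  Rintegral mu setT (fun x : borel G =>
    cmod (\sum_(0 <= k < n) a k * chi k x) ^+ 2) =
  \sum_(0 <= k < n) cmod (a k) ^+ 2.
Proof.
move=> hc ic; pose S x := \sum_(0 <= k < n) a k * chi k x.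
have IS : cintegrable mu (S : borel G -> R[i]).
  have [] // := @cintegral_sum _ _ _ mu (fun k x => a k * chi k x) n.
  by move=> k; have [] := cintegralZ (a k) (cintegrable_character (hc k)).
have [_ e] := cint_mul_trig_poly a n IS hc.
transitivity (complex.Re (cintegral mu (fun x => S x * (S x)^*%C))).
  by congr (Rintegral _ _ _); apply/funext => x; rewrite /= sqr_cmodC.
rewrite e Re_sum; apply: eq_big_nat => k /andP[_ kn].
rewrite fourier_trig_poly// (bigD1_seq k) ?mem_index_iota ?iota_uniq//=.
rewrite asboolT// mulr1 big1 ?addr0 => [|j jk].
  by rewrite mulrC sqr_cmodC.
by rewrite asboolF ?mulr0// => /ic jk'; rewrite jk' eqxx in jk.
Qed.

(** Let [S] be the projection of [f] and [s] the left-hand side. The pointwise inequality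
    $2\,\mathrm{Re}(f\bar S)-|S|^2\le|f|^2$ is integrated; its left side has integral
    [2 * s - s]. *)
Lemma bessel f (chi : nat -> G -> R[i]) n :
  cmeasurable (f : borel G -> R[i]) ->
  (\int[mu]_x (cmod (f (x : borel G)) ^+ 2)%:E < +oo)%E ->
  (forall k, is_character (chi k)) -> injective chi ->
  \sum_(0 <= k < n) cmod (fourier mu f (chi k)) ^+ 2 <=
  Rintegral mu setT (fun x : borel G => cmod (f x) ^+ 2).
Proof.
move=> mf f2 hc ic; pose a k := fourier mu f (chi k).
pose S x := \sum_(0 <= k < n) a k * chi k x.
have i2 : mu.-integrable setT (EFin \o (fun x : borel G => cmod (f x) ^+ 2)).
  apply/integrableP; split.
    exact/measurable_EFinP/measurable_funX/measurable_cmod.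
  under eq_integral do rewrite /= ger0_norm ?sqr_ge0//.
  exact: f2.
have If : cintegrable mu (f : borel G -> R[i]).
  apply: cintegrableP => //.
  (* On a probability space square-integrability gives integrability, through $t\le1+t^2$. *)
  apply: (@le_lt_trans _ _ (\int[mu]_x (1 + (cmod (f (x : borel G)) ^+ 2)%:E))%E).
    apply: ge0_le_integral => //.
    - by move=> x _; rewrite lee_fin cmod_ge0.
    - exact/measurable_EFinP/measurable_cmod.
    - apply: emeasurable_funD => //; exact: measurable_int i2.
    - move=> x _; rewrite -EFinD lee_fin.
      have := sqr_ge0 (cmod (f x) - 1); have := cmod_ge0 (f x); nra.
  rewrite ge0_integralD//; last first.
  - exact: measurable_int i2.
  - by move=> x _; rewrite lee_fin sqr_ge0.
  rewrite integral_cst//= (_ : mu setT = 1%E) ?mule1; last exact: probability_setT.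
  by rewrite lte_add_pinfty// ltry.
have [I1 e1] := cint_mul_trig_poly a n If hc.
have IS : cintegrable mu (S : borel G -> R[i]).
  have [] // := @cintegral_sum _ _ _ mu (fun k x => a k * chi k x) n.
  by move=> k; have [] := cintegralZ (a k) (cintegrable_character (hc k)).
have [I2 _] := cint_mul_trig_poly a n IS hc.
have e2 := cintegral_sqr_trig_poly a n hc ic.
have e3 : complex.Re (cintegral mu (fun x => f x * (S x)^*%C)) =
    \sum_(0 <= k < n) cmod (a k) ^+ 2.
  rewrite e1 Re_sum; apply: eq_bigr => k _.
  by rewrite mulrC sqr_cmodC.
have I2' : mu.-integrable setT (EFin \o (fun x : borel G => cmod (S x) ^+ 2)).
  have [I2' _] := I2; apply: eq_integrable I2' => // x _.
  by rewrite /= sqr_cmodC.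
rewrite -/a; set s := \sum_(0 <= k < n) _ in e2 e3 *.
have -> : s = Rintegral mu setT (fun x : borel G =>
    2 * complex.Re (f x * (S x)^*%C) - cmod (S x) ^+ 2).
  rewrite RintegralB// ?RintegralZl//; last 2 first.
  - by have [I1' _] := I1.
  - by have [I1' _] := I1; have := integrableZl measurableT 2 I1'.
  rewrite e2; have -> : Rintegral mu setT (fun x : borel G =>
    complex.Re (f x * (S x)^*%C)) = s by [].
  by ring.
apply: le_Rintegral => //.
  have [I1' _] := I1.
  by have := integrableB measurableT (integrableZl measurableT 2 I1') I2'.
move=> x _; rewrite !sqr_cmod cReM cReJ cImJ.
rewrite -subr_ge0.
have := sqr_ge0 (complex.Re (f x) - complex.Re (S x)).
have := sqr_ge0 (complex.Im (f x) - complex.Im (S x)).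
by nra.
Qed.

End haar_measure.

(** * The frequency *)

Section dyadic_blocks.

Lemma trunc_log_block k j : (j < 2 ^ k)%N -> trunc_log 2 ((2 ^ k).-1 + j).+1 = k.
Proof.
move=> jk; have k0 : (0 < 2 ^ k)%N by rewrite expn_gt0.
apply: trunc_log_eq => //; rewrite -addSn prednK// leq_addr/= expnS mul2n -addnn.
by rewrite ltn_add2l.
Qed.

Lemma block_decomp n : exists k j, (j < 2 ^ k)%N /\ n = ((2 ^ k).-1 + j)%N.
Proof.
have /andP[h1 h2] := trunc_log_bounds (isT : 1 < 2)%N (isT : 0 < n.+1)%N.
set k := trunc_log 2 n.+1 in h1 h2.
exists k, (n.+1 - 2 ^ k)%N; split.
  by rewrite ltn_subLR// addnn -mul2n -expnS.
have k0 : (0 < 2 ^ k)%N by rewrite expn_gt0.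
by apply/eqP; rewrite -eqSS -addSn prednK// subnKC.
Qed.

(** The first [K] blocks have $1+2+\dots+2^{K-1}=2^K-1$ elements, so partial sums of this length
    split into whole blocks. *)
Lemma sum_blocks (V : nmodType) (F : nat -> V) K :
  \sum_(0 <= n < (2 ^ K).-1) F n =
  \sum_(0 <= k < K) \sum_(0 <= j < 2 ^ k) F ((2 ^ k).-1 + j)%N.
Proof.
elim: K => [|K IH]; first by rewrite expn0 !big_geq.
have K0 : (0 < 2 ^ K)%N by rewrite expn_gt0.
have e : ((2 ^ K.+1).-1 = (2 ^ K).-1 + 2 ^ K)%N.
  by rewrite expnS mul2n -addnn -subn1 -addnBAC// subn1.
rewrite big_nat_recr//= -IH (big_cat_nat _ (n := (2 ^ K).-1))//=; last first.
  by rewrite e leq_addr.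
congr (_ + _); rewrite -{1}[(2 ^ K).-1]add0n big_addn e addKn.
by apply: eq_bigr => j _; rewrite addnC.
Qed.

End dyadic_blocks.

Section frequency.
Variable R : realType.

Definition step : R := Num.sqrt 2 - 1.

Lemma step_sqr : step ^+ 2 = 1 - 2 * step.
Proof.
have : Num.sqrt 2 ^+ 2 = 2 :> R by rewrite sqr_sqrtr.
by rewrite /step; set s := Num.sqrt 2 => h; rewrite sqrrB1 h mulr_natl; ring.
Qed.

Lemma step_gt0 : 0 < step.
Proof. by rewrite subr_gt0 -{1}sqrtr1 ltr_sqrt// ltr1n. Qed.

Lemma stepX_ge0 k : 0 <= step ^+ k.
Proof. by rewrite exprn_ge0// ltW// step_gt0. Qed.

Lemma step_lt_half : 2 * step < 1.
Proof. by have := step_sqr; have := step_gt0; nra. Qed.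

Lemma step_lt1 : step < 1.
Proof. by have := step_lt_half; have := step_gt0; lra. Qed.

(* The $2^k$ frequencies of block [k] are $k + j\delta^k$ for $j < 2^k$, where
   [n.+1 = 2 ^ k + j] and $\delta=\sqrt2-1$. *)
Definition lam (n : nat) : R :=
  let k := trunc_log 2 n.+1 in k%:R + (n.+1 - 2 ^ k)%:R * step ^+ k.

Lemma lam_block k j : (j < 2 ^ k)%N ->
  lam ((2 ^ k).-1 + j) = k%:R + j%:R * step ^+ k.
Proof.
move=> jk; rewrite /lam trunc_log_block//.
by rewrite -addSn prednK ?expn_gt0// addKn.
Qed.

Lemma block_width k : (2 ^ k)%:R * step ^+ k <= 1.
Proof.
rewrite natrX -exprMn exprn_ile1//; first by rewrite mulr_ge0// ltW// step_gt0.
exact/ltW/step_lt_half.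
Qed.

Lemma lam_block_bounds k j : (j < 2 ^ k)%N ->
  k%:R <= lam ((2 ^ k).-1 + j) <= k%:R + 1.
Proof.
move=> jk; rewrite lam_block// lerDl lerD2l mulr_ge0 ?stepX_ge0//=.
apply: le_trans (block_width k); apply: ler_wpM2r; first exact: stepX_ge0.
by rewrite ler_nat ltnW.
Qed.

Lemma lam_gap k j : (j < 2 ^ k)%N ->
  step ^+ k <= lam ((2 ^ k).-1 + j).+1 - lam ((2 ^ k).-1 + j).
Proof.
move=> jk; rewrite (lam_block jk).
have k0 : (0 < 2 ^ k)%N by rewrite expn_gt0.
have [jk1|jk1] := ltnP j.+1 (2 ^ k).
  rewrite -addnS lam_block// -natr1.
  by set d := step ^+ k; lra.
(* Here [j] is the last position of block [k] and the next frequency is [k + 1]; the gap is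
   $1-(2^k-1)\delta^k$, and [block_width] bounds it below by $\delta^k$. *)
have -> : ((2 ^ k).-1 + j).+1 = ((2 ^ k.+1).-1 + 0)%N.
  have -> : j = (2 ^ k).-1 by apply/eqP; rewrite -eqSS prednK// eqn_leq jk jk1.
  by rewrite addn0 expnS mul2n -addnn; case: (2 ^ k)%N k0 => // m _; rewrite addSn/= addnS.
rewrite lam_block ?expn_gt0// mul0r addr0 -natr1.
have := block_width k; have -> : (2 ^ k = j.+1)%N by apply/eqP; rewrite eqn_leq jk jk1.
by rewrite -natr1; set d := step ^+ k; lra.
Qed.

Lemma lam_lt n : lam n < lam n.+1.
Proof.
have [k [j [jk ->]]] := block_decomp n.
rewrite -subr_gt0; apply: lt_le_trans (lam_gap jk).
by rewrite exprn_gt0// step_gt0.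
Qed.

Lemma lam_homo : {homo lam : m n / (m < n)%N >-> m < n}.
Proof. by apply: homo_ltn lam_lt => y x z; exact: lt_trans. Qed.

Lemma lam_inj : injective lam.
Proof.
move=> m n e; have [mn|nm|//] := ltngtP m n.
  by have := lam_homo mn; rewrite e ltxx.
by have := lam_homo nm; rewrite e ltxx.
Qed.

Lemma lam_ge0 n : 0 <= lam n.
Proof.
have [k [j [jk ->]]] := block_decomp n.
by have /andP[+ _] := lam_block_bounds jk; apply: le_trans.
Qed.

Lemma lam_frequency : is_frequency lam.
Proof.
split; [exact: lam_homo|exact: lam_ge0|].
apply/cvgryPge => A; pose K := (Num.trunc `|A|).+1.
near=> n; have Kn : ((2 ^ K).-1 <= n)%N by near: n; exact: nbhs_infty_ge.
apply: (@le_trans _ _ (lam (2 ^ K).-1)); last first.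
  move: Kn; rewrite leq_eqVlt => /predU1P[->//|Kn].
  by apply/ltW; exact: lam_homo.
have := @lam_block K 0; rewrite addn0 mul0r addr0 expn_gt0 => -> //.
by apply: (le_trans (ler_norm A)); apply/ltW; rewrite truncnS_gt.
Unshelve. all: by end_near. Qed.

Lemma lam_BC : cond_BC lam.
Proof.
(* With this exponent the lower bound is [step] to the power [lam n], which is at most [step ^+ k]
   because [k <= lam n]. *)
exists (- ln step), 1; split => //.
  by rewrite oppr_gt0 ln_lt0// step_gt0 step_lt1.
move=> n; have [k [j [jk ->]]] := block_decomp n.
rewrite mul1r opprK; apply: le_trans (lam_gap jk).
rewrite -[X in _ <= X ^+ _]lnK ?posrE ?step_gt0// -expRM_natl ler_expR mulrC.
rewrite ler_wnM2r//; first by rewrite ltW// ln_lt0// step_gt0 step_lt1.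
by have /andP[] := lam_block_bounds jk.
Qed.

(** Block [k] has $2^k$ terms, each at most $e^{-kx}$, so it contributes at most $r^k$ with
    $r=2e^{-x}<1$. *)
Lemma exp_lam_summable (x : R) : ln 2 < x ->
  cvgn (series (fun n => expR (- (lam n * x)))).
Proof.
move=> x2; have x0 : 0 < x by apply: lt_trans x2; rewrite ln_gt0// ltr1n.
pose r := 2 * expR (- x).
have r0 : 0 <= r by rewrite mulr_ge0 ?expR_ge0.
have r1 : r < 1.
  by rewrite /r expRN ltr_pdivrMr ?expR_gt0// mul1r -[ltLHS]lnK ?posrE// ltr_expR.
apply: nondecreasing_is_cvgn.
  by apply: nondecreasing_series => k _ _; exact: expR_ge0.
exists (1 - r)^-1 => _ [N _ <-].
(* The terms are nonnegative, so a partial sum may be prolonged to the end of a block. *)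
have NN : (N <= (2 ^ N).-1)%N by rewrite -ltnS prednK ?expn_gt0// ltn_expl.
apply: (@le_trans _ _ (series (fun n => expR (- (lam n * x))) (2 ^ N).-1)).
  rewrite /series/= (big_cat_nat _ NN)//= lerDl.
  by apply: sumr_ge0 => k _; exact: expR_ge0.
rewrite /series/= sum_blocks.
apply: (@le_trans _ _ (\sum_(0 <= k < N) r ^+ k)).
  apply: ler_sum => k _; rewrite exprMn -natrX mulr_natl.
  apply: (@le_trans _ _ (\sum_(0 <= j < 2 ^ k) expR (- x) ^+ k)); last first.
    by rewrite big_const_nat iter_addr_0 subn0.
  rewrite big_nat_cond [leRHS]big_nat_cond; apply: ler_sum => j.
  rewrite andbT => /andP[_ jk]; have /andP[lk _] := lam_block_bounds jk.
  rewrite -expRM_natl ler_expR mulrN lerN2; apply: ler_wpM2r => //; exact: ltW.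
have -> : \sum_(0 <= k < N) r ^+ k = series (geometric 1 r) N.
  by rewrite /series/=; apply: eq_bigr => k _; rewrite mul1r.
rewrite geometric_seriesE ?lt_eqF//= mul1r ler_pdivrMr ?subr_gt0//.
by rewrite mulVf ?gt_eqF ?subr_gt0// gerBl exprn_ge0.
Qed.

End frequency.

(** * Convergence of complex Dirichlet series *)

Section convergence.
Variable R : realType.

Lemma complex_series_cvg (u : nat -> R[i]) :
  cvgn (series (fun n => cmod (u n))) -> cvgn (series (u : nat -> R[i]^o)).
Proof.
move=> cu.
have c (h : nat -> R) : (forall n, `|h n| <= cmod (u n)) -> cvgn (series h).
  move=> hu; apply: (@normed_cvg _ R^o); apply: series_le_cvg hu cu => n.
    exact: normr_ge0.
  exact: cmod_ge0.
have cr := c (fun n => complex.Re (u n)) (fun n => Re_le_cmod (u n)).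
have ci := c (fun n => complex.Im (u n)) (fun n => Im_le_cmod (u n)).
pose l := (limn (series (fun n => complex.Re (u n))) +i*
           limn (series (fun n => complex.Im (u n))))%C.
apply/cvg_ex; exists (l : R[i]^o); apply/cvg_complexP; split.
  by under eq_fun do rewrite /series/= Re_sum; exact: cr.
by under eq_fun do rewrite /series/= Im_sum; exact: ci.
Qed.

Lemma dirichlet_abs_cvg (lam : nat -> R) (a : nat -> R[i]) (s : R[i]) :
  cvgn (series (fun n => cmod (a n) * expR (- (lam n * complex.Re s)))) ->
  dirichlet_cvg lam a s.
Proof.
have e : (fun n => cmod (a n) * expR (- (lam n * complex.Re s))) =
    (fun n => cmod (a n * cexp (- ((lam n)%:C%C * s)))).
  apply/funext => n; rewrite cmodM cmod_cexp; congr (_ * expR _).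
  by case: s => x y /=; rewrite mul0r subr0.
by rewrite e; exact: complex_series_cvg.
Qed.

(** Reduces the lower bounds to real series: the test series have real nonnegative coefficients, so
    nothing is lost. *)
Lemma dirichlet_cvg_real (lam : nat -> R) (a : nat -> R[i]) (x : R) :
  dirichlet_cvg lam a x%:C%C ->
  cvgn (series (fun n => complex.Re (a n) * expR (- (lam n * x)))).
Proof.
move=> /cvg_ex[l /cvg_complexP[cr _]]; apply/cvg_ex; exists (complex.Re l).
rewrite [X in X @ _ --> _](_ : _ = (fun n => complex.Re
  (series (fun n => a n * cexp (- ((lam n)%:C%C * x%:C%C))) n)))//.
apply/funext => n; rewrite /series/= Re_sum.
apply: eq_bigr => k _; rewrite -rmorphM -rmorphN/= cexp_real cReM/=.
by rewrite mulr0 subr0.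
Qed.

End convergence.

(** * The torus *)

Section continuity.
Variables (R : realType) (X Y Z : topologicalType).

Lemma continuous_comp_fun (f : X -> Y) (g : Y -> Z) :
  continuous f -> continuous g -> continuous (fun x => g (f x)).
Proof. by move=> cf cg x; apply: continuous_comp; [exact: cf|exact: cg]. Qed.

Lemma continuous_pair (f : X -> Y) (g : X -> Z) :
  continuous f -> continuous g -> continuous (fun x => (f x, g x)).
Proof. by move=> cf cg x; apply: cvg_pair => /=; [exact: cf|exact: cg]. Qed.

Lemma continuous_fst : continuous (fst : Y * Z -> Y).
Proof. by move=> x; exact: cvg_fst. Qed.

Lemma continuous_snd : continuous (snd : Y * Z -> Z).
Proof. by move=> x; exact: cvg_snd. Qed.

Lemma continuous_addr (f g : X -> R) :
  continuous f -> continuous g -> continuous (fun x => f x + g x).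
Proof. by move=> cf cg x; apply: cvgD; [exact: cf|exact: cg]. Qed.

Lemma continuous_oppr (f : X -> R) : continuous f -> continuous (fun x => - f x).
Proof. by move=> cf x; apply: cvgN; exact: cf. Qed.

Lemma continuous_mulr (f g : X -> R) :
  continuous f -> continuous g -> continuous (fun x => f x * g x).
Proof. by move=> cf cg x; apply: cvgM; [exact: cf|exact: cg]. Qed.

End continuity.

Section torus_type.
Variable R : realType.

(** Two unit vectors of the plane, rather than a quotient of it: the topology and the metric are
    then induced from the ambient normed space, and group operations are polynomial in the
    coordinates. *)
Definition on_torus : set ((R * R) * (R * R)) :=
  [set p | p.1.1 ^+ 2 + p.1.2 ^+ 2 = 1 /\ p.2.1 ^+ 2 + p.2.2 ^+ 2 = 1].

Definition torus : Type := set_type on_torus.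

Definition torus_val (x : torus) : (R * R) * (R * R) := set_val x.

Definition mk_torus p (h : on_torus p) : torus := exist _ p (mem_set h).

Lemma torus_valP x : on_torus (torus_val x).
Proof. exact: set_valP. Qed.

Lemma torus_val_inj : injective torus_val.
Proof. exact: val_inj. Qed.

Definition complex_mul (p q : R * R) : R * R :=
  (p.1 * q.1 - p.2 * q.2, p.1 * q.2 + p.2 * q.1).

Lemma torus_add_subproof x y : on_torus
  (complex_mul (torus_val x).1 (torus_val y).1,
   complex_mul (torus_val x).2 (torus_val y).2).
Proof.
have [x1 x2] := torus_valP x; have [y1 y2] := torus_valP y.
have brahmagupta (a b c d : R) : (a * c - b * d) ^+ 2 + (a * d + b * c) ^+ 2 =
  (a ^+ 2 + b ^+ 2) * (c ^+ 2 + d ^+ 2) by ring.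
by split => /=; rewrite brahmagupta ?x1 ?x2 ?y1 ?y2 mulr1.
Qed.

Lemma torus_opp_subproof x : on_torus
  (((torus_val x).1.1, - (torus_val x).1.2),
   ((torus_val x).2.1, - (torus_val x).2.2)).
Proof. by have [x1 x2] := torus_valP x; split => /=; rewrite sqrrN. Qed.

Lemma torus_zero_subproof : on_torus ((1, 0), (1, 0)).
Proof. by split; rewrite /= expr1n expr0n addr0. Qed.

Definition torus_add x y := mk_torus (torus_add_subproof x y).
Definition torus_opp x := mk_torus (torus_opp_subproof x).
Definition torus_zero := mk_torus torus_zero_subproof.

Lemma torus_addA : associative torus_add.
Proof.
by move=> x y z; apply: torus_val_inj; congr ((_, _), (_, _)) => /=; ring.
Qed.

Lemma torus_addC : commutative torus_add.
Proof.
by move=> x y; apply: torus_val_inj; congr ((_, _), (_, _)) => /=; ring.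
Qed.

Lemma torus_add0 : left_id torus_zero torus_add.
Proof.
move=> x; apply: torus_val_inj; rewrite [RHS]surjective_pairing.
rewrite [X in (X, _)]surjective_pairing [X in (_, X)]surjective_pairing.
by congr ((_, _), (_, _)) => /=; ring.
Qed.

Lemma torus_addN : left_inverse torus_zero torus_opp torus_add.
Proof.
move=> x; have [x1 x2] := torus_valP x; apply: torus_val_inj.
congr ((_, _), (_, _)) => /=; rewrite ?mulNr ?opprK -?expr2 //.
  by rewrite mulrC subrr.
by rewrite mulrC subrr.
Qed.

End torus_type.

HB.instance Definition _ (R : realType) := Choice.on (torus R).
HB.instance Definition _ (R : realType) := PseudoMetric.on (torus R).
HB.instance Definition _ (R : realType) := GRing.isZmodule.Build (torus R)
  (@torus_addA R) (@torus_addC R) (@torus_add0 R) (@torus_addN R).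

Section torus_topology.
Variable R : realType.

Lemma torus_val_continuous : continuous (@torus_val R).
Proof. exact: initial_continuous. Qed.

Lemma continuous_to_torus (X : topologicalType) (f : X -> torus R) :
  continuous (@torus_val R \o f) -> continuous f.
Proof.
move=> /continuousP cf; apply/continuousP => _ [U oU <-].
by have := cf U oU; rewrite -comp_preimage.
Qed.

Lemma torus_coord_continuous :
  [/\ continuous (fun x : torus R => (torus_val x).1.1),
      continuous (fun x : torus R => (torus_val x).1.2),
      continuous (fun x : torus R => (torus_val x).2.1)
    & continuous (fun x : torus R => (torus_val x).2.2)].
Proof.
have c1 := continuous_comp_fun torus_val_continuous (@continuous_fst _ _).
have c2 := continuous_comp_fun torus_val_continuous (@continuous_snd _ _).
split.
- exact: (continuous_comp_fun c1 (@continuous_fst _ _)).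
- exact: (continuous_comp_fun c1 (@continuous_snd _ _)).
- exact: (continuous_comp_fun c2 (@continuous_fst _ _)).
- exact: (continuous_comp_fun c2 (@continuous_snd _ _)).
Qed.

Lemma torus_add_continuous :
  continuous (fun x : torus R * torus R => x.1 + x.2).
Proof.
have [c1 c2 c3 c4] := torus_coord_continuous.
have fs (h : torus R -> R) (ch : continuous h) :=
  continuous_comp_fun (@continuous_fst (torus R) (torus R)) ch.
have sn (h : torus R -> R) (ch : continuous h) :=
  continuous_comp_fun (@continuous_snd (torus R) (torus R)) ch.
apply: continuous_to_torus.
have re (a b : torus R -> R) (ca : continuous a) (cb : continuous b) :=
  continuous_addr (continuous_mulr (fs _ ca) (sn _ ca))
    (continuous_oppr (continuous_mulr (fs _ cb) (sn _ cb))).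
have im (a b : torus R -> R) (ca : continuous a) (cb : continuous b) :=
  continuous_addr (continuous_mulr (fs _ ca) (sn _ cb))
    (continuous_mulr (fs _ cb) (sn _ ca)).
exact: (continuous_pair (continuous_pair (re _ _ c1 c2) (im _ _ c1 c2))
  (continuous_pair (re _ _ c3 c4) (im _ _ c3 c4))).
Qed.

Lemma torus_opp_continuous : continuous (-%R : torus R -> torus R).
Proof.
have [c1 c2 c3 c4] := torus_coord_continuous.
apply: continuous_to_torus.
exact: (continuous_pair (continuous_pair c1 (continuous_oppr c2))
  (continuous_pair c3 (continuous_oppr c4))).
Qed.

End torus_topology.

HB.instance Definition _ (R : realType) :=
  PreTopologicalNmodule_isTopologicalNmodule.Build (torus R)
    (@torus_add_continuous R).
HB.instance Definition _ (R : realType) :=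
  TopologicalNmodule_isTopologicalZmodule.Build (torus R)
    (@torus_opp_continuous R).

Section torus_angle.
Variable R : realType.

(** Angles are measured in full turns, so that [angle] has period 1 in each coordinate and the unit
    square is a fundamental domain. *)
Definition turn : R := pi *+ 2.

Definition angle_val (s : R * R) : (R * R) * (R * R) :=
  ((cos (turn * s.1), sin (turn * s.1)), (cos (turn * s.2), sin (turn * s.2))).

Lemma angle_subproof s : on_torus (angle_val s).
Proof. by split; rewrite /= cos2Dsin2. Qed.

Definition angle (s : R * R) : torus R := mk_torus (angle_subproof s).

Lemma torus_val_angle s : torus_val (angle s) = angle_val s.
Proof. by []. Qed.

Lemma torus_valD (x y : torus R) : torus_val (x + y) =
  (complex_mul (torus_val x).1 (torus_val y).1,
   complex_mul (torus_val x).2 (torus_val y).2).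
Proof. by []. Qed.

Lemma angleD (a b c d : R) : angle (a + c, b + d) = angle (a, b) + angle (c, d).
Proof.
apply: torus_val_inj; rewrite torus_valD !torus_val_angle /angle_val/=.
rewrite !mulrDr !cosD !sinD.
by congr ((_, _), (_, _)); rewrite /=; ring.
Qed.

Lemma cos_sin_turn_int (m : int) : cos (turn * m%:~R) = 1 /\ sin (turn * m%:~R) = 0 :> R.
Proof.
have nat_case n : cos (turn * n%:R) = 1 /\ sin (turn * n%:R) = 0 :> R.
  have := periodicn (@cosD2pi R) n 0; have := periodicn (@sinD2pi R) n 0.
  by rewrite !add0r cos0 sin0 -[_ *+ n]mulr_natr.
case: m => n; first exact: nat_case.
rewrite NegzE mulrNz mulrN cosN sinN; have [-> ->] := nat_case n.+1.
by rewrite oppr0.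
Qed.

Lemma angle_int (m n : int) : angle (m%:~R, n%:~R) = 0.
Proof.
apply: torus_val_inj; rewrite torus_val_angle /angle_val/=.
by have [-> ->] := cos_sin_turn_int m; have [-> ->] := cos_sin_turn_int n.
Qed.

Lemma angle_continuous : continuous angle.
Proof.
have lin (p : R * R -> R) : continuous p ->
    continuous (fun s => cos (turn * p s)) /\ continuous (fun s => sin (turn * p s)).
  move=> cp; split => s; apply: continuous_comp.
  - by apply: cvgM; [exact: cvg_cst|exact: cp].
  - exact: continuous_cos.
  - by apply: cvgM; [exact: cvg_cst|exact: cp].
  - exact: continuous_sin.
have [c1 s1] := lin fst (fun s => @cvg_fst _ _ _ _ _).
have [c2 s2] := lin snd (fun s => @cvg_snd _ _ _ _ _).
by apply: continuous_to_torus; apply: continuous_pair; apply: continuous_pair.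
Qed.

Lemma circle_angle (x y : R) : x ^+ 2 + y ^+ 2 = 1 ->
  exists s, [/\ 0 <= s <= 1, cos (turn * s) = x & sin (turn * s) = y].
Proof.
move=> xy; have x1 : -1 <= x <= 1.
  by rewrite -ler_norml -(@ler_pXn2r _ 2)// ?nnegrE// real_normK ?num_real// expr1n;
    have := sqr_ge0 y; lra.
have xI : x \in `[(-1), 1] by rewrite in_itv.
have pi0 := @pi_gt0 R; have turn0 : 0 < turn by rewrite pmulrn_lgt0.
have sqy : Num.sqrt (1 - x ^+ 2) = `|y|.
  by rewrite -xy addrAC subrr add0r sqrtr_sqr.
have a0 := acos_ge0 x1; have api := acos_lepi x1.
have a01 : 0 <= acos x / turn <= 1.
  apply/andP; split; first by rewrite divr_ge0// ltW.
  by rewrite ler_pdivrMr// mul1r (le_trans api)// /turn mulr2n; lra.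
have [y0|y0] := lerP 0 y.
  exists (acos x / turn); rewrite mulrCA divff ?gt_eqF// mulr1.
  by rewrite acosK// sin_acos// sqy ger0_norm//; split.
(* [acos] takes its values in $[0,\pi]$ and reaches only the upper half circle; the lower half is
   its reflection. *)
exists (1 - acos x / turn); rewrite mulrBr mulr1 mulrCA divff ?gt_eqF// mulr1.
rewrite cosB sinB cos2pi sin2pi !mul0r !mul1r addr0 sub0r acosK// sin_acos//.
rewrite sqy ltr0_norm// opprK; split => //.
by move/andP: a01; lra.
Qed.

Lemma angle_surj (x : torus R) :
  exists2 s, (`[0, 1] `*` `[0, 1]) s & angle s = x.
Proof.
have [h1 h2] := torus_valP x.
have [s [s01 cs ss]] := circle_angle h1; have [t [t01 ct st]] := circle_angle h2.
exists (s, t); first by split; rewrite /= in_itv.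
apply: torus_val_inj; rewrite torus_val_angle /angle_val/= cs ss ct st.
by move: (torus_val x) => [[? ?] [? ?]].
Qed.

Lemma torus_compact : compact [set: torus R].
Proof.
have -> : [set: torus R] = angle @` (`[0, 1] `*` `[0, 1]).
  by apply/seteqP; split => // x _; have [s ? <-] := angle_surj x; exists s.
apply: continuous_compact; first exact/continuous_subspaceT/angle_continuous.
by apply: compact_setX; exact: segment_compact.
Qed.

Lemma torus_hausdorff : hausdorff_space (torus R).
Proof.
move=> x y xy; apply: torus_val_inj.
have H : hausdorff_space ((R * R) * (R * R))%type by exact: norm_hausdorff.
apply: H => A B nA nB.
have [z [Az Bz]] := xy _ _ (torus_val_continuous nA) (torus_val_continuous nB).
by exists (torus_val z).
Qed.

End torus_angle.

(** * Characters along a one-parameter subgroup *)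

Section frequencies_of_characters.
Variables (R : realType) (G : topologicalZmodType) (beta : R -> G).
Implicit Types (chi psi : G -> R[i]) (x y : R).

Lemma is_hP x chi : is_h beta x chi <->
  is_character chi /\ forall t, chi (beta t) = (cos (x * t) -i* sin (x * t))%C.
Proof.
split=> -[hc e]; split => // t; first by rewrite e cexp_imag.
by rewrite cexp_imag e.
Qed.

Lemma is_hM x y chi psi : is_h beta x chi -> is_h beta y psi ->
  is_h beta (x + y) (fun z => chi z * psi z).
Proof.
move=> [hc ec] [hp ep]; split; first exact: characterM.
move=> t; rewrite ec ep -cexpD; congr cexp.
by rewrite mulrDl rmorphD/= mulrDr opprD.
Qed.

Lemma is_hJ x chi : is_h beta x chi -> is_h beta (- x) (fun z => (chi z)^*%C).
Proof.
move=> /is_hP[hc ec]; apply/is_hP; split; first exact: characterJ.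
by move=> t; rewrite ec mulNr cosN sinN opprK /= opprK.
Qed.

Lemma is_hX x chi n : is_h beta x chi -> is_h beta (n%:R * x) (fun z => chi z ^+ n).
Proof.
move=> h; elim: n => [|n IH].
  apply/is_hP; split; first exact/characterX/h.1.
  by move=> t; rewrite expr0 !mul0r cos0 sin0 oppr0.
have -> : n.+1%:R * x = x + n%:R * x by rewrite -natr1 mulrDl mul1r addrC.
have -> : (fun z => chi z ^+ n.+1) = (fun z => chi z * chi z ^+ n).
  by apply/funext => z; rewrite exprS.
exact: is_hM.
Qed.

Lemma is_h_inj x y chi : is_h beta x chi -> is_h beta y chi -> x = y.
Proof.
move=> /is_hP[_ hx] /is_hP[_ hy]; apply/eqP; rewrite -subr_eq0; apply/negPn/negP => xy.
(* At this [t] the angles [x * t] and [y * t] differ by [pi], while equal values of the character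
   force the cosine of their difference to be 1. *)
pose t := pi / (x - y); have /esym := hx t; rewrite hy => -[ec /oppr_inj es].
have : cos ((x - y) * t) = 1.
  by rewrite mulrBl cosB -ec -es -!expr2 cos2Dsin2.
by rewrite /t mulrCA divff// mulr1 cospi => h; have := @ltr01 R; lra.
Qed.

(** The real part of [chi] times the conjugate of [psi] is 1 on a dense set, hence everywhere by
    continuity; as the product has modulus 1, its imaginary part vanishes. *)
Lemma is_h_unique x chi psi : dense (range beta) ->
  is_h beta x chi -> is_h beta x psi -> chi = psi.
Proof.
move=> db [hc ec] [hp ep].
have hq := characterM hc (characterJ hp).
pose g z := complex.Re (chi z * (psi z)^*%C).
have cg : continuous (g : G -> R).
  by have /continuous_complexP[] := character_continuous hq.
have g1 z : g z = 1.
  apply/eqP/negPn/negP => gz.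
  have oU : open [set w | g w != 1].
    by apply: (@open_comp _ _ g [set r | r != 1]) => //; exact: open_neq.
  have [|w [gw [t _ tw]]] := db [set w | g w != 1] _ oU; first by exists z.
  by move: gw; rewrite /= /g -tw ec -ep mul_conj_character// eqxx.
apply/funext => z.
have e : chi z * (psi z)^*%C = 1.
  have n1 : cmod (chi z * (psi z)^*%C) ^+ 2 = 1.
    by rewrite (cmod_character z hq) expr1n.
  apply: complex_eq; first exact: g1.
  apply/eqP; rewrite -sqrf_eq0; move: n1; rewrite sqr_cmod -/(g z) g1 expr1n.
  by move=> /eqP; rewrite -subr_eq0 addrAC subrr add0r.
have := congr1 (fun w => w * psi z) e; rewrite mul1r -mulrA [_^*%C * _]mulrC.
by rewrite mul_conj_character// mulr1.
Qed.

End frequencies_of_characters.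

(** * The dense flow on the torus and its characters *)

Section torus_flow.
Variable R : realType.

Definition lattice (x : R) := exists m n : int, x = m%:~R * step R + n%:~R.

Lemma latticeD x y : lattice x -> lattice y -> lattice (x + y).
Proof.
move=> [a [b ->]] [c [d ->]]; exists (a + c), (b + d); rewrite !rmorphD/=; ring.
Qed.

Lemma latticeM (n : int) x : lattice x -> lattice (n%:~R * x).
Proof.
move=> [a [b ->]]; exists (n * a), (n * b); rewrite !rmorphM/=; ring.
Qed.

Lemma lattice_int (n : int) : lattice n%:~R.
Proof. by exists 0, n; rewrite mul0r add0r. Qed.

Lemma lattice_stepX k : lattice (step R ^+ k).
Proof.
elim: k => [|k [m [n e]]]; first by exists 0, 1; rewrite mul0r add0r expr0.
(* $\delta(m\delta+n)=m(1-2\delta)+n\delta=(n-2m)\delta+m$. *)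
exists (n - m *+ 2), m; rewrite exprS e mulrDr mulrCA -expr2 step_sqr.
by rewrite rmorphB/= rmorphMn/= mulr2n; ring.
Qed.

Lemma lattice_lam n : lattice (lam R n).
Proof.
apply: latticeD; first exact: (lattice_int (Posz _)).
exact: (latticeM (Posz _) (lattice_stepX _)).
Qed.

(** The powers $\delta^k$ are positive lattice elements tending to 0, and some integer multiple of
    $\delta^k$ lies within $\delta^k$ of [r]. *)
Lemma lattice_dense (r e : R) : 0 < e ->
  exists m n : int, `|m%:~R * step R + n%:~R - r| < e.
Proof.
move=> e0; have [k ke] : exists k, step R ^+ k < e.
  have := @cvg_expr R (step R); rewrite ger0_norm ?ltW ?step_gt0//.
  move=> /(_ (step_lt1 R)) /cvgrPdist_lt/(_ e e0)[k _ /(_ k)] /=.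
  rewrite leqnn => /(_ isT); rewrite sub0r normrN ger0_norm ?stepX_ge0// => ke.
  by exists k.
have d0 : 0 < step R ^+ k by rewrite exprn_gt0// step_gt0.
have [m [n emn]] := latticeM (Num.floor (r / step R ^+ k)) (lattice_stepX k).
exists m, n; rewrite -emn; apply: le_lt_trans ke.
have := floor_le_tmp (r / step R ^+ k); have := lt_succ_floor (r / step R ^+ k).
rewrite rmorphD/= ltr_pdivrMr// ler_pdivlMr//.
set q := (_%:~R); set d := step R ^+ k => h1 h2.
rewrite ler_norml; apply/andP; split; lra.
Qed.

Definition flow (t : R) : torus R := angle (t / turn R, step R * (t / turn R)).

Lemma flowD s t : flow (s + t) = flow s + flow t.
Proof. by rewrite /flow -angleD; congr (angle (_, _)); ring. Qed.

Lemma flow_continuous : continuous flow.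
Proof.
have c1 : continuous (fun t : R => t / turn R).
  exact: (continuous_mulr (fun x => cvg_id) (fun x => cvg_cst _)).
apply: (continuous_comp_fun _ (@angle_continuous R)).
apply: (continuous_pair c1).
exact: (continuous_mulr (fun x => cvg_cst _) c1).
Qed.

Lemma turn_neq0 : turn R != 0.
Proof. by rewrite /turn mulrn_eq0/= gt_eqF// pi_gt0. Qed.

(** At the times $2\pi(a+m)$ the first coordinate is already the right one. The second is $\delta
    a+m\delta$ modulo 1, and density of the lattice brings it close to [b]. *)
Lemma flow_dense : dense (range flow).
Proof.
move=> O [x Ox] oO; have [[a b] _ abx] := angle_surj x.
have cab : continuous (fun c : R => angle (a, c)).
  apply: (continuous_comp_fun _ (@angle_continuous R)).
  exact: (continuous_pair (fun x => cvg_cst _) (fun x => cvg_id)).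
have /cab : nbhs (angle (a, b)) O by rewrite abx; apply: open_nbhs_nbhs; split.
rewrite /= -nbhs_ballE => -[e /= e0 be].
have [m [n mn]] := lattice_dense (b - step R * a) e0.
exists (angle (a, step R * a + (m%:~R * step R + n%:~R))); split.
  apply: be; rewrite /ball/=; apply: le_lt_trans mn.
  rewrite le_eqVlt; apply/orP; left; apply/eqP; rewrite distrC.
  by congr (`| _ |); ring.
exists (turn R * (a + m%:~R)) => //; rewrite /flow mulrAC divff ?turn_neq0// mul1r.
have -> : step R * (a + m%:~R) =
    (step R * a + (m%:~R * step R + n%:~R)) + (- n)%:~R.
  by rewrite rmorphN/=; ring.
by rewrite angleD angle_int addr0.
Qed.

(** The conjugate of the coordinate, because $h_\lambda$ restricts to $e^{-i\lambda t}$ along the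
    flow. *)
Definition coord_char (p : R * R) : R[i] := (p.1 -i* p.2)%C.

Lemma coord_char_character (c : torus R -> R * R) : continuous c ->
  (forall x y, c (x + y) = complex_mul (c x) (c y)) ->
  (forall x, (c x).1 ^+ 2 + (c x).2 ^+ 2 = 1) ->
  is_character (fun x => coord_char (c x)).
Proof.
move=> cc cD c1; split.
- apply/continuous_complexP; split.
    exact: (continuous_comp_fun cc (@continuous_fst _ _)).
  exact: (continuous_oppr (continuous_comp_fun cc (@continuous_snd _ _))).
- move=> x y; rewrite cD /coord_char /complex_mul.
  by apply: complex_eq; rewrite !(cReM, cImM)/=; ring.
- by move=> x; rewrite normC_cmod cmodE/= sqrrN c1 sqrtr1.
Qed.

Lemma is_h_flow1 : is_h flow 1 (fun x => coord_char (torus_val x).1).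
Proof.
apply/is_hP; split.
  apply: coord_char_character => //.
    exact: (continuous_comp_fun (@torus_val_continuous R) (@continuous_fst _ _)).
  by move=> x; have [] := torus_valP x.
move=> t; rewrite /flow torus_val_angle /coord_char/=.
by rewrite mulrC divfK ?turn_neq0// mul1r.
Qed.

Lemma is_h_flow2 : is_h flow (step R) (fun x => coord_char (torus_val x).2).
Proof.
apply/is_hP; split.
  apply: coord_char_character => //.
    exact: (continuous_comp_fun (@torus_val_continuous R) (@continuous_snd _ _)).
  by move=> x; have [] := torus_valP x.
move=> t; rewrite /flow torus_val_angle /coord_char/=.
by rewrite mulrCA [turn R * _]mulrC divfK ?turn_neq0.
Qed.

Lemma is_h_lattice x : lattice x -> exists chi, is_h flow x chi.
Proof.
move=> [m [n ->]].
have int_mul y chi (p : int) : is_h flow y chi -> exists psi, is_h flow (p%:~R * y) psi.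
  move=> h; case: p => p; first by eexists; exact: is_hX h.
  by rewrite NegzE mulrNz mulNr; eexists; exact: is_hJ (is_hX p.+1 h).
have [chi hchi] := int_mul _ _ m is_h_flow2.
have [psi] := int_mul _ _ n is_h_flow1; rewrite mulr1 => hpsi.
by eexists; exact: is_hM hchi hpsi.
Qed.

Lemma torus_dirichlet_group : is_dirichlet_group (lam R) flow.
Proof.
split.
- by split; [exact: torus_compact|exact: torus_hausdorff].
- exact: flow_continuous.
- exact: flowD.
- exact: flow_dense.
- by move=> n; apply: is_h_lattice; exact: lattice_lam.
Qed.

End torus_flow.

(** * Haar measure on the torus *)

Section regularity.
Variables (R : realType) (G : topologicalZmodType).
Variable mu : probability (borel G) R.

Lemma borel_open (U : set G) : open U -> measurable (U : set (borel G)).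
Proof. exact: sub_sigma_algebra. Qed.

Lemma borel_closed (F : set G) : closed F -> measurable (F : set (borel G)).
Proof.
by move=> /closed_openC/borel_open/measurableC; rewrite setCK.
Qed.

Lemma small_tail (F : nat -> set (borel G)) (e : R) :
  (forall n, measurable (F n)) -> 0 < e ->
  exists N, (mu ((\bigcup_n F n) `\` \big[setU/set0]_(i < N) F i) < e%:E)%E.
Proof.
move=> mF e0; pose D N := (\bigcup_n F n) `\` \big[setU/set0]_(i < N) F i.
have mD N : measurable (D N).
  apply: measurableD; first exact: bigcupT_measurable.
  by apply: bigsetU_measurable.
have D0 : \bigcap_n D n = set0.
  apply/seteqP; split => // x Dx; have [[n _ Fnx] _] := Dx 0%N I.
  have [_] := Dx n.+1 I; apply; rewrite -bigcup_mkord; exists n => //=.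
have dD : {homo D : n m / (n <= m)%N >-> (m <= n)%O}.
  move=> n m nm; apply/subsetPset => x [Ux nUx]; split => // h; apply: nUx.
  move: h; rewrite -!bigcup_mkord => -[i /= im Fix]; exists i => //=.
  exact: leq_trans im nm.
have cD : mu (D n) @[n --> \oo] --> 0%E.
  have := @nonincreasing_cvg_mu _ _ _ mu D _ mD _ dD.
  rewrite D0 measure0; apply => //.
  by rewrite (le_lt_trans (probability_le1 _ _))// ltry.
have /fine_cvgP[_ /cvgrPdist_lt/(_ e e0)[N _ /(_ N)]] := cD.
rewrite /= leqnn sub0r normrN => /(_ isT) h; exists N.
have f : mu (D N) \is a fin_num by rewrite fin_num_measure.
by rewrite -[X in (X < _)%E](fineK f) lte_fin; exact: le_lt_trans (ler_norm _) h.
Qed.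

Definition approximable (A : set G) := forall e : R, 0 < e ->
  exists U F : set G, [/\ open U, closed F, F `<=` A, A `<=` U
    & (mu ((U `\` F) : set (borel G)) < e%:E)%E].

Lemma closed_bigsetU_ord (F : nat -> set G) N :
  (forall n, closed (F n)) -> closed (\big[setU/set0]_(i < N) F i).
Proof.
move=> cF; elim: N => [|N IH]; first by rewrite big_ord0; exact: closed0.
by rewrite big_ord_recr/=; exact: closedU.
Qed.

Hypothesis open_Fsigma : forall U : set G, open U ->
  exists2 F : nat -> set G, (forall n, closed (F n)) & U = \bigcup_n F n.

(** The approximable sets form a sigma-algebra that contains the open sets: complements exchange the
    roles of [U] and [F], and an open set is exhausted by finite unions of its closed pieces. *)
Lemma borel_approximable (A : set (borel G)) : measurable A -> approximable A.
Proof.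
suff sub : <<s (open : set (set G)) >> `<=` approximable by exact: sub.
apply: smallest_sub.
- split => [|B apB e e0|B apB e e0].
  + move=> e e0; exists set0, set0; split => //; first exact: open0.
      exact: closed0.
    by rewrite set0D measure0 lte_fin.
  + have [U [F [oU cF FA AU UF]]] := apB e e0.
    exists (~` F), (~` U); split.
    * exact: closed_openC.
    * exact: open_closedC.
    * by move=> x nUx; split => // /AU.
    * by move=> x [_ nBx] /FA.
    * by rewrite setDE setCK setIC -setDE.
  + have h n : exists UF : set G * set G,
      [/\ open UF.1, closed UF.2, UF.2 `<=` B n, B n `<=` UF.1
      & (mu ((UF.1 `\` UF.2) : set (borel G)) < ((e / 2) / (2 ^ n.+1)%:R)%:E)%E].
      have [|U [F h]] := apB n ((e / 2) / (2 ^ n.+1)%:R); last by exists (U, F).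
      by rewrite !divr_gt0// ltr0n expn_gt0.
    have [UF /all_and5[oU cF FA AU mUF]] := choice h.
    pose U n := (UF n).1; pose F n := (UF n).2.
    have mU n : measurable (U n : set (borel G)) by apply: borel_open; exact: oU.
    have mF n : measurable (F n : set (borel G)) by apply: borel_closed; exact: cF.
    have e2 : 0 < e / 2 by rewrite divr_gt0.
    have [N FN] := small_tail mF e2.
    (* An infinite union of closed sets need not be closed, so only [N] of them are kept. The tail
       costs [e / 2], and the differences of [U n] and [F n] share the other half. *)
    exists (\bigcup_n U n), (\big[setU/set0]_(i < N) F i); split.
    * by apply: bigcup_open => n _; exact: oU.
    * exact: closed_bigsetU_ord.
    * move=> x; rewrite -bigcup_mkord => -[i _ Fix]; exists i => //; exact: FA.
    * by move=> x [i _ Aix]; exists i => //; exact: AU.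
    * pose T := (\bigcup_n F n) `\` \big[setU/set0]_(i < N) F i.
      pose W := \bigcup_n (U n `\` F n).
      have mW : measurable (W : set (borel G)).
        by apply: bigcupT_measurable => n; exact: measurableD.
      have mT : measurable (T : set (borel G)).
        by apply: measurableD; [exact: bigcupT_measurable|by apply: bigsetU_measurable].
      apply: (@le_lt_trans _ _ (mu (W `|` T : set (borel G)))).
        apply: le_measure; rewrite ?inE.
        - by apply: measurableD; [exact: bigcupT_measurable|by apply: bigsetU_measurable].
        - exact: measurableU.
        - move=> x [[n _ Unx] nF]; have [[m _ Fmx]|nFx] := pselect ((\bigcup_n F n) x).
            by right; split => //; exists m.
          by left; exists n => //; split => // Fnx; apply: nFx; exists n.
      apply: (@le_lt_trans _ _ (mu (W : set (borel G)) + mu (T : set (borel G)))%E).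
        exact: measureU2.
      have -> : e%:E = ((e / 2)%:E + (e / 2)%:E)%E by rewrite -EFinD -splitr.
      apply: lee_ltD => //; first by rewrite fin_num_measure.
      apply: le_trans (epsilon_trick0 xpredT (ltW e2)).
      apply: (@le_trans _ _ (\sum_(0 <= n <oo) mu (U n `\` F n : set (borel G)))%E).
        apply: measure_sigma_subadditive => //.
        by move=> n; exact: measurableD.
      by apply: lee_nneseries => // n _; exact/ltW/mUF.
- move=> U oU e e0; have [F cF UF] := open_Fsigma oU.
  have mF n : measurable (F n : set (borel G)) by exact: borel_closed.
  have [N FN] := small_tail mF e0.
  exists U, (\big[setU/set0]_(i < N) F i); split => //.
  + exact: closed_bigsetU_ord.
  + by rewrite UF => x; rewrite -bigcup_mkord => -[i _ Fix]; exists i.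
  + by rewrite UF.
Qed.

Lemma outer_regular (A : set (borel G)) : measurable A ->
  mu A = ereal_inf [set mu U | U in [set U : set G | open U /\ A `<=` U]].
Proof.
move=> mA; apply/eqP; rewrite eq_le; apply/andP; split.
  apply: le_ereal_inf_tmp => _ [U [oU AU] <-].
  by apply: le_measure; rewrite ?inE//; exact: borel_open.
apply/lee_addgt0Pr => e e0.
have [U [F [oU cF FA AU UF]]] := borel_approximable mA e0.
apply: (@le_trans _ _ (mu (U : set (borel G)))).
  by apply: ereal_inf_lbound; exists U.
have mU := borel_open oU; have mF := borel_closed cF.
apply: (@le_trans _ _ (mu (A `|` (U `\` F) : set (borel G)))).
  apply: le_measure; rewrite ?inE//.
    by apply: measurableU => //; exact: measurableD.
  move=> x Ux; have [Fx|nFx] := pselect (F x); first by left; exact: FA.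
  by right.
apply: le_trans (measureU2 _ _ _) _ => //; first exact: measurableD.
by apply: leeD2l; exact: ltW.
Qed.

End regularity.

(** * Lebesgue measure on the unit square and its image on the torus *)

Section uniform_measure.
Variable R : realType.
Notation L := (@lebesgue_measure R).
Notation mR := (measurableTypeR R).

(** The image of Lebesgue measure under the translation agrees with it on half-open intervals, and
    these determine it. *)
Lemma lebesgue_translation (a : R) (A : set mR) : measurable A ->
  L ((fun x => x + a) @^-1` A) = L A.
Proof.
move=> mA; pose phi : mR -> mR := fun x : R => x + a.
have mphi : measurable_fun setT phi by exact: measurable_funD.
apply/esym; apply: (@lebesgue_measure_unique R (pushforward L phi)) => //.
move=> _ [[x y] _ <-] /=; rewrite /pushforward.
have -> : phi @^-1` `]x, y] = `]x - a, y - a]%classic.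
  by apply/seteqP; split => z; rewrite /= !in_itv/= lerBrDr ltrBlDr.
rewrite !lebesgue_measure_itv/= !lte_fin ltrD2r; case: ifP => // _.
by rewrite -!EFinB; congr (_%:E); ring.
Qed.

Let mI : measurable (`[0, 1[%classic : set mR).
Proof. exact: measurable_itv. Qed.

Definition unif : set mR -> \bar R := mrestr L mI.

HB.instance Definition _ := Measure.on unif.

Let unif_setT : unif setT = 1%E.
Proof.
rewrite /unif /mrestr setTI lebesgue_measure_itv/= lte_fin ltr01.
by rewrite -EFinB subr0.
Qed.

HB.instance Definition _ := Measure_isProbability.Build _ _ _ unif unif_setT.

Definition rot (a s : R) : R := if s + a < 1 then s + a else s + a - 1.

Lemma measurable_rot a : measurable_fun setT (rot a : mR -> mR).
Proof.
apply: measurable_fun_ifT.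
- by apply: measurable_fun_ltr => //; exact: measurable_funD.
- exact: measurable_funD.
- by apply: measurable_funB => //; exact: measurable_funD.
Qed.

Lemma unif_rot (a : R) (B : set mR) : 0 <= a <= 1 -> measurable B ->
  unif (rot a @^-1` B) = unif B.
Proof.
move=> /andP[a0 a1] mB; rewrite /unif /mrestr.
have mi (x y : R) : measurable (B `&` `[x, y[ : set mR).
  by apply: measurableI => //; exact: measurable_itv.
have mpre (c : R) (A : set mR) : measurable A ->
    measurable ((fun x => x + c) @^-1` A : set mR).
  move=> mA; rewrite -[X in measurable X]setTI.
  have : measurable_fun setT (fun x : mR => (x + c : mR)) by exact: measurable_funD.
  exact.
have -> : rot a @^-1` B `&` `[0, 1[ =
    ((fun x => x + a) @^-1` (B `&` `[a, 1[)) `|`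
    ((fun x => x + (a - 1)) @^-1` (B `&` `[0, a[)).
  apply/seteqP; split => s; rewrite /= /rot !in_itv/=.
    move=> [+ /andP[s0 s1]]; case: ltP => sa Bs; [left|right]; split.
    - exact: Bs.
    - by rewrite lerDr s0.
    - by rewrite addrA.
    - by apply/andP; split; lra.
  move=> [[Bs /andP[s1 s2]]|[Bs /andP[s1 s2]]].
    by rewrite s2; split => //; apply/andP; split; lra.
  have -> : (s + a < 1) = false by apply/negbTE; rewrite -leNgt; lra.
  by rewrite -addrA; split => //; apply/andP; split; lra.
rewrite measureU; [|exact: mpre|exact: mpre|]; last first.
  apply/seteqP; split => // s /= [[_ +] [_ +]]; rewrite !in_itv/=.
  by move=> /andP[h1 h2] /andP[h3 h4]; lra.
transitivity (L (B `&` `[a, 1%R[) + L (B `&` `[0%R, a[))%E.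
  by congr (_ + _)%E; exact: lebesgue_translation.
rewrite addeC -measureU//; last first.
  apply/seteqP; split => // s /= [[_ +] [_ +]]; rewrite !in_itv/=.
  by move=> /andP[h1 h2] /andP[h3 h4]; lra.
congr (L _); rewrite -setIUr; congr (_ `&` _).
apply/seteqP; split => s /=; rewrite !in_itv/=.
  by move=> [/andP[h1 h2]|/andP[h1 h2]]; apply/andP; split; lra.
by move=> /andP[h1 h2]; case: (ltP s a) => sa; [left|right]; apply/andP; split.
Qed.

(** Bridges the Borel sets of the plane, from which the torus gets its own, and the product
    sigma-algebra, on which the product measure lives: [U] is a countable union of squares with
    rational centres. *)
Lemma open_measurable_prod (U : set (R * R)) : open U ->
  measurable (U : set (mR * mR)).
Proof.
move=> oU.
pose B (q : rat * rat * nat) : set (mR * mR) :=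
  ball (ratr q.1.1 : R) (q.2.+1%:R^-1) `*` ball (ratr q.1.2 : R) (q.2.+1%:R^-1).
have -> : U = \bigcup_(q in setT) (if `[< B q `<=` U >] then B q else set0).
  apply/seteqP; split => [[x y] Uxy|p [q _]]; last by case: asboolP => // h /h.
  have : nbhs (x, y) U by apply: open_nbhs_nbhs.
  rewrite -nbhs_ballE => -[e /= e0 eU].
  (* The square contains [(x, y)] away from its centre, so half of [e] goes to each leg of the
     triangle inequality. *)
  have [n ne] : exists n : nat, n.+1%:R^-1 < e / 2.
    exists (Num.trunc (e / 2)^-1); rewrite invf_plt ?posrE ?divr_gt0//.
    by rewrite truncnS_gt.
  have n0 : 0 < n.+1%:R^-1 :> R by rewrite invr_gt0.
  have rat_near (z : R) : exists q : rat, `|ratr q - z| < n.+1%:R^-1.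
    have [|q] := @rat_in_itvoo R z (z + n.+1%:R^-1); first by rewrite ltrDl.
    rewrite in_itv/= => /andP[zq qz]; exists q.
    by rewrite ger0_norm ?subr_ge0 ?(ltW zq)// ltrBlDl.
  have [qx hx] := rat_near x; have [qy hy] := rat_near y.
  exists (qx, qy, n) => //; case: asboolP => [_|]; first by split.
  case=> -[u v] [/= hu hv]; apply: eU; split; rewrite /ball/=.
    apply: le_lt_trans (ler_distD (ratr qx) _ _) _; rewrite distrC in hx.
    by apply: lt_trans (ltrD hx hu) _; rewrite [ltRHS]splitr; exact: ltrD.
  apply: le_lt_trans (ler_distD (ratr qy) _ _) _; rewrite distrC in hy.
  by apply: lt_trans (ltrD hy hv) _; rewrite [ltRHS]splitr; exact: ltrD.
apply: countable_bigcupT_measurable => [|q]; first exact: countableP.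
case: ifPn => // _; apply: measurableX; apply: open_measurable; exact: ball_open.
Qed.

Lemma measurable_angle : measurable_fun setT
  (@angle R : mR * mR -> borel (torus R)).
Proof.
apply: (@measurability _ _ _ _ setT (@angle R : mR * mR -> borel (torus R)) open) => //.
move=> _ [U oU <-]; rewrite setTI; apply: open_measurable_prod.
have /continuousP := @angle_continuous R; exact.
Qed.

HB.instance Definition _ := isMeasurableFun.Build _ _ _ _
  (@angle R : mR * mR -> borel (torus R)) measurable_angle.

Definition torus_measure : probability (borel (torus R)) R :=
  distribution (unif \x unif)%E (@angle R : {mfun (mR * mR)%type >-> borel (torus R)}).

Lemma angle_rot (a b : R) (s : R * R) :
  angle (rot a s.1, rot b s.2) = angle (a, b) + angle s.
Proof.
have rot_int c r : exists m : int, rot c r = c + r + m%:~R.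
  rewrite /rot; case: ifP => _; first by exists 0; rewrite addr0 addrC.
  by exists (-1); rewrite mulrN1z addrC [r + c]addrC addrC.
have [m ->] := rot_int a s.1; have [n ->] := rot_int b s.2.
by rewrite angleD angle_int addr0 angleD; case: s.
Qed.

(** Pulled back to the square, translation by [angle (a, b)] becomes rotation in each coordinate, by
    [angle_rot]; this preserves the product measure. *)
Lemma torus_measure_invariant (x : torus R) (A : set (borel (torus R))) :
  measurable A ->
  torus_measure [set (x + y : torus R) | y in (A : set (torus R))] =
  torus_measure A.
Proof.
move=> mA; have [[a b] [/= ha hb] <-] := angle_surj x.
rewrite !in_itv/= in ha hb.
pose xA : set (borel (torus R)) :=
  [set (angle (a, b) + y : torus R) | y in (A : set (torus R))].
have mxA : measurable xA.
  have -> : xA = (fun y : torus R => - angle (a, b) + y) @^-1` (A : set (torus R)).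
    apply/seteqP; split => [_ [y Ay <-]|y Ay] /=; first by rewrite addKr.
    by exists (- angle (a, b) + y) => //; rewrite addNKr.
  rewrite -[X in measurable X]setTI.
  pose phi : borel (torus R) -> borel (torus R) :=
    fun y : torus R => - angle (a, b) + y.
  have mt : measurable_fun setT phi.
    apply: (@measurability _ _ _ _ setT phi open) => //.
    move=> _ [U oU <-]; rewrite setTI; apply: sub_sigma_algebra.
    have /continuousP := @translation_continuous (torus R) (- angle (a, b)); exact.
  exact: mt.
pose B : set (mR * mR) := (@angle R) @^-1` (xA : set (torus R)).
have mB : measurable B.
  by rewrite -[X in measurable X]setTI; exact: measurable_angle.
pose rho (s : mR * mR) : mR * mR := (rot a s.1, rot b s.2).
have mrho : measurable_fun setT rho.
  apply/measurable_fun_pairP; split.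
    exact: (measurableT_comp (measurable_rot a) measurable_fst).
  exact: (measurableT_comp (measurable_rot b) measurable_snd).
have inv : (unif \x unif)%E B = (unif \x unif)%E (rho @^-1` B).
  (* It suffices to compare the two measures on rectangles, where [unif_rot] applies to each
     side. *)
  apply: (@product_measure_unique _ _ _ _ _ _ _ (pushforward (unif \x unif)%E rho)) => //.
  move=> C D mC mD; rewrite /pushforward/=.
  transitivity ((unif \x unif)%E ((rot a @^-1` C) `*` (rot b @^-1` D))).
    by [].
  rewrite product_measure1E.
  - by congr (_ * _)%E; exact: unif_rot.
  - by rewrite -[X in measurable X]setTI; exact: measurable_rot.
  - by rewrite -[X in measurable X]setTI; exact: measurable_rot.
rewrite /torus_measure /= /distribution /pushforward -/xA -/B inv.
congr ((unif \x unif)%E _); apply/seteqP; split => s; rewrite /B /rho /= angle_rot.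
  by move=> [y Ay /addrI <-].
by move=> As; exists (angle s).
Qed.

(** The n-th piece is the closure of the points at distance about $1/(n+1)$ from the complement. It
    stays in [U]: a limit point lies in the ball around some nearby point of the set. *)
Lemma torus_open_Fsigma (U : set (torus R)) : open U ->
  exists2 F : nat -> set (torus R), (forall n, closed (F n)) & U = \bigcup_n F n.
Proof.
move=> oU; exists (fun n => closure [set x | ball x (n.+1%:R^-1 : R) `<=` U]).
  by move=> n; exact: closed_closure.
apply/seteqP; split => [x Ux|x [n _ clx]].
  have : nbhs x U by apply: open_nbhs_nbhs.
  rewrite -nbhs_ballE => -[e /= e0 eU].
  exists (Num.trunc e^-1) => //; apply: subset_closure => /=.
  apply: subset_trans eU; apply: le_ball; apply/ltW.
  by rewrite invf_plt ?posrE// truncnS_gt.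
have n0 : 0 < n.+1%:R^-1 :> R by rewrite invr_gt0.
have [y [yU xy]] := clx _ (nbhsx_ballx x _ n0).
by apply: yU; exact: ball_sym.
Qed.

Lemma torus_measure_haar : is_haar torus_measure.
Proof.
split; first exact: torus_measure_invariant.
by move=> A mA; exact: (@outer_regular R (torus R) torus_measure torus_open_Fsigma A mA).
Qed.

End uniform_measure.

(** * Abscissas of convergence *)

Section complex_sum.
Context d (T : measurableType d) (R : realType).
Variables (mu : probability T R) (u : nat -> T -> R[i]) (c : nat -> R).
Hypothesis mu_ : forall k, cmeasurable (u k).
Hypothesis c0 : forall k, 0 < c k.
Hypothesis cc : cvgn (series c).
Hypothesis u1 : forall k, (\int[mu]_x (cmod (u k x))%:E <= 1)%E.

(** Stated for a generic [p] so that it applies to the real and to the imaginary part of the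
    blocks. *)
Let component (p : R[i] -> R) : (forall z, `|p z| <= cmod z) ->
  (forall k, measurable_fun setT (fun x => p (u k x))) ->
  exists F : T -> R,
  [/\ measurable_fun setT F, mu.-integrable setT (EFin \o F),
    (forall h : T -> R, measurable_fun setT h -> (forall x, `|h x| <= 1) ->
      (\sum_(0 <= k < n) c k * Rintegral mu setT (fun x => p (u k x) * h x))
         @[n --> \oo] --> Rintegral mu setT (fun x => F x * h x)) &
    (forall k, \int[mu]_x (cmod (u k x) ^+ 2)%:E <= 1)%E ->
      (\int[mu]_x (F x ^+ 2)%:E < +oo)%E].
Proof.
move=> pc mp; pose v k x := c k * p (u k x).
have mv k : measurable_fun setT (v k) by exact: measurable_funM.
have bound (g : T -> R) (m : R) : 0 <= m -> measurable_fun setT g ->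
    (forall x, 0 <= g x) -> (\int[mu]_x (g x)%:E <= 1)%E ->
    (\int[mu]_x (m * g x)%:E <= m%:E)%E.
  move=> m0 mg g0 g1; under eq_integral do rewrite EFinM.
  rewrite ge0_integralZl//; first by rewrite -[leRHS]mule1; exact: lee_wpmul2l.
  - exact/measurable_EFinP.
  - by move=> x _; rewrite lee_fin.
have vc k : (\int[mu]_x `|v k x|%:E <= (c k)%:E)%E.
  apply: le_trans (bound (fun x => cmod (u k x)) _ (ltW (c0 k)) _ _ (u1 k)).
  - apply: ge0_le_integral => //.
    + by apply/measurable_EFinP; apply: measurableT_comp.
    + apply/measurable_EFinP/measurable_funM => //; exact: measurable_cmod.
    + move=> x _; rewrite lee_fin normrM gtr0_norm//.
      by rewrite ler_wpM2l// ltW.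
  - exact: measurable_cmod.
  - by move=> x; exact: cmod_ge0.
have [F [mF iF hF F2]] := integrable_sum_L1 mv c0 cc vc.
have ip k : mu.-integrable setT (EFin \o (fun x => p (u k x))).
  apply/integrableP; split; first exact/measurable_EFinP.
  apply: (@le_lt_trans _ _ 1%E); last by rewrite ltry.
  apply: le_trans (u1 k); apply: ge0_le_integral => //.
  - by apply: measurableT_comp => //; exact/measurable_EFinP.
  - exact/measurable_EFinP/measurable_cmod.
  - by move=> x _; rewrite /= lee_fin.
exists F; split => // [h mh h1|u2].
  have e : (fun n => \sum_(0 <= k < n)
        c k * Rintegral mu setT (fun x => p (u k x) * h x)) =
      (fun n => \sum_(0 <= k < n) Rintegral mu setT (fun x => v k x * h x)).
    apply/funext => n; apply: eq_bigr => k _.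
    rewrite -RintegralZl//; last first.
      apply: le_integrable (ip k) => //.
        by apply/measurable_EFinP; exact: measurable_funM.
      by move=> x _; rewrite /= lee_fin normrM ler_piMr.
    by apply: eq_Rintegral => x _; rewrite /v mulrA.
  by rewrite e; exact: hF.
apply: F2 => k; apply: le_trans (bound (fun x => cmod (u k x) ^+ 2) _ _ _ _ (u2 k)).
- apply: ge0_le_integral => //.
  + by move=> x _; rewrite lee_fin sqr_ge0.
  + by apply/measurable_EFinP; exact: measurable_funX.
  + apply/measurable_EFinP/measurable_funM => //.
    exact/measurable_funX/measurable_cmod.
  + move=> x _; rewrite lee_fin /v exprMn ler_wpM2l ?sqr_ge0//.
    by rewrite -(@real_normK _ (p _)) ?num_real// ler_pXn2r ?nnegrE ?cmod_ge0.
- exact: sqr_ge0.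
- exact/measurable_funX/measurable_cmod.
- by move=> x; exact: sqr_ge0.
Qed.

(** When [g] is a conjugate character, orthogonality makes all but at most one block vanish. The
    partial sums are then eventually constant, so the coefficient clause is stated in this form. *)
Lemma complex_sum_L1 : exists f : T -> R[i],
  [/\ cmeasurable f, (\int[mu]_x (cmod (f x))%:E < +oo)%E,
    (forall (g : T -> R[i]) (z : R[i]), cmeasurable g ->
      (forall x, cmod (g x) <= 1) ->
      (\forall n \near \oo,
        \sum_(0 <= k < n) (c k)%:C%C * cint mu (fun x => u k x * g x) = z) ->
      cint mu (fun x => f x * g x) = z) &
    (forall k, \int[mu]_x (cmod (u k x) ^+ 2)%:E <= 1)%E ->
      (\int[mu]_x (cmod (f x) ^+ 2)%:E < +oo)%E].
Proof.
have [F1 [mF1 iF1 h1 F12]] :=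
  component (@Re_le_cmod R) (fun k => (mu_ k).1).
have [F2 [mF2 iF2 h2 F22]] :=
  component (@Im_le_cmod R) (fun k => (mu_ k).2).
have iu k : cintegrable mu (u k).
  by apply: cintegrableP => //; exact: le_lt_trans (u1 k) (ltry _).
exists (fun x => (F1 x +i* F2 x)%C); split => [//||g z mg g1 ev|u2].
- have i12 := integrableD measurableT (integrable_abse iF1) (integrable_abse iF2).
  have /integrableP[_] := i12; apply: le_lt_trans; apply: ge0_le_integral => //.
  + by move=> x _; rewrite lee_fin cmod_ge0.
  + by apply/measurable_EFinP; apply: measurable_cmod.
  + by apply: measurableT_comp => //; exact: measurable_int i12.
  + move=> x _; rewrite [leRHS]gee0_abs ?adde_ge0//= -EFinD lee_fin.
    exact: cmod_le_ReIm.
- have [mg1 mg2] := mg.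
  have hg1 x : `|complex.Re (g x)| <= 1 := le_trans (Re_le_cmod _) (g1 x).
  have hg2 x : `|complex.Im (g x)| <= 1 := le_trans (Im_le_cmod _) (g1 x).
  have bd (F h : T -> R) : mu.-integrable setT (EFin \o F) ->
      measurable_fun setT h -> (forall x, `|h x| <= 1) ->
      mu.-integrable setT (EFin \o (fun x => F x * h x)).
    move=> iF mh hh; have mF : measurable_fun setT F.
      by apply/measurable_EFinP; exact: measurable_int iF.
    apply: (le_integrable _ _ _ iF) => //.
      exact/measurable_EFinP/measurable_funM.
    by move=> x _; rewrite /= lee_fin normrM ler_piMr.
  have split_re (a b : T -> R) (ia : mu.-integrable setT (EFin \o a))
      (ib : mu.-integrable setT (EFin \o b)) :=
    RintegralB measurableT (bd _ _ ia mg1 hg1) (bd _ _ ib mg2 hg2).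
  have split_im (a b : T -> R) (ia : mu.-integrable setT (EFin \o a))
      (ib : mu.-integrable setT (EFin \o b)) :=
    RintegralD measurableT (bd _ _ ia mg2 hg2) (bd _ _ ib mg1 hg1).
  have e1 k : complex.Re (cint mu (fun x => u k x * g x)) =
      Rintegral mu setT (fun x => complex.Re (u k x) * complex.Re (g x)) -
      Rintegral mu setT (fun x => complex.Im (u k x) * complex.Im (g x)).
    rewrite -(split_re _ _ (iu k).1 (iu k).2) /cint/=.
    by apply: eq_Rintegral => x _; rewrite cReM.
  have e2 k : complex.Im (cint mu (fun x => u k x * g x)) =
      Rintegral mu setT (fun x => complex.Re (u k x) * complex.Im (g x)) +
      Rintegral mu setT (fun x => complex.Im (u k x) * complex.Re (g x)).
    rewrite -(split_im _ _ (iu k).1 (iu k).2) /cint/=.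
    by apply: eq_Rintegral => x _; rewrite cImM.
  have lim_uniq (s : nat -> R) x y : s n @[n --> \oo] --> x ->
      (\forall n \near \oo, s n = y) -> x = y.
    move=> sx sy; apply: (@cvg_unique _ (@Rhausdorff R) (s @ \oo) _ x y sx).
    exact: cvg_near_cst.
  apply: complex_eq.
    rewrite /cint/=; under eq_Rintegral do rewrite cReM/=.
    rewrite (split_re _ _ iF1 iF2).
    apply: (lim_uniq _ _ _ (cvgB (h1 _ mg1 hg1) (h2 _ mg2 hg2))).
    apply: filterS ev => n <-.
    rewrite fctE Re_sum -sumrB; apply: eq_bigr => k _.
    by rewrite cReZ e1 mulrBr.
  rewrite /cint/=; under eq_Rintegral do rewrite cImM/=.
  rewrite (split_im _ _ iF1 iF2).
  apply: (lim_uniq _ _ _ (cvgD (h1 _ mg2 hg2) (h2 _ mg1 hg1))).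
  apply: filterS ev => n <-.
  rewrite Im_sum -big_split; apply: eq_bigr => k _.
  by rewrite cImZ e2 mulrDr.
- under eq_integral do rewrite sqr_cmod/= EFinD.
  rewrite ge0_integralD//; first by rewrite lte_add_pinfty ?F12 ?F22.
  + by move=> x _; rewrite lee_fin sqr_ge0.
  + by apply/measurable_EFinP; exact: measurable_funX.
  + by move=> x _; rewrite lee_fin sqr_ge0.
  + by apply/measurable_EFinP; exact: measurable_funX.
Qed.

End complex_sum.

Section upper_bounds.
Variable R : realType.
Implicit Types a : nat -> R[i].

Lemma sigma_c_le a (l : R) :
  (forall x, l < x -> cvgn (series (fun n => cmod (a n) * expR (- (lam R n * x))))) ->
  (sigma_c (lam R) a <= l%:E)%E.
Proof.
move=> h; apply: ereal_inf_lbound; exists l => // s ls.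
by apply: dirichlet_abs_cvg; exact: h.
Qed.

Lemma sigma_c_H1_le a : Hp (lam R) 1%:E a -> (sigma_c (lam R) a <= (ln 2)%:E)%E.
Proof.
move=> [G [beta [mu [f [dg hmu [fL _] ha]]]]].
have [mf f1] := (in_Lp1P mu f).1 fL.
pose r := fine (\int[mu]_x (cmod (f (x : borel G)))%:E)%E.
have rE : (\int[mu]_x (cmod (f (x : borel G)))%:E = r%:E)%E.
  rewrite fineK// ge0_fin_numE//; apply: integral_ge0 => x _.
  by rewrite lee_fin cmod_ge0.
(* [r] is the $L_1$ norm of [f]; it is counted once for each of the real and imaginary parts. *)
have bound n : cmod (a n) <= r + r.
  have [_ _ _ _ /(_ n)[chi hchi]] := dg.
  rewrite (ha n chi hchi) (le_trans (cmod_le_ReIm _))//.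
  have hc := hchi.1.
  have mfc := cmeasurableM mf
    (continuous_cmeasurable (character_continuous (characterJ hc))).
  have [|h1 h2] := @cintegral_bound _ _ _ mu _ r mfc.
    by rewrite -rE; under eq_integral do rewrite cmodM cmodJ (cmod_character _ hc) mulr1.
  by rewrite lerD.
apply: sigma_c_le => x /exp_lam_summable cx.
have cK : cvgn (series (fun n => (r + r) * expR (- (lam R n * x)))).
  exact: is_cvg_seriesZ cx.
apply: series_le_cvg cK => n.
- by rewrite mulr_ge0 ?cmod_ge0 ?expR_ge0.
- by rewrite mulr_ge0 ?expR_ge0// (le_trans _ (bound n))// cmod_ge0.
- by rewrite ler_wpM2r ?expR_ge0.
Qed.

Lemma sigma_c_H2_le a : Hp (lam R) 2%:E a -> (sigma_c (lam R) a <= (ln 2 / 2)%:E)%E.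
Proof.
move=> [G [beta [mu [f [dg hmu [fL _] ha]]]]].
have [mf f2] := (in_Lp2P mu f).1 fL.
have [_ _ _ _ /choice[chi hchi]] := dg.
(* A character determines its frequency, and the frequencies are distinct. *)
have ichi : injective chi.
  move=> m n e; apply: (@lam_inj R); have := hchi n; rewrite -e => h.
  exact: is_h_inj (hchi m) h.
have cs : cvgn (series (fun n => cmod (a n) ^+ 2)).
  apply: nondecreasing_is_cvgn.
    by apply: nondecreasing_series => k _ _; exact: sqr_ge0.
  exists (Rintegral mu setT (fun x : borel G => cmod (f x) ^+ 2)) => _ [n _ <-].
  have := bessel hmu n mf f2 (fun k => (hchi k).1) ichi.
  apply: le_trans; rewrite le_eqVlt; apply/orP; left; apply/eqP.
  by apply: eq_bigr => k _; rewrite (ha k _ (hchi k)).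
apply: sigma_c_le => x lx.
have /exp_lam_summable c2 : ln 2 < x * 2 by rewrite -ltr_pdivrMr.
have cD : cvgn (series (fun n => cmod (a n) ^+ 2 + expR (- (lam R n * (x * 2))))).
  exact: is_cvg_seriesD cs c2.
apply: series_le_cvg cD => n.
- by rewrite mulr_ge0 ?cmod_ge0 ?expR_ge0.
- by rewrite addr_ge0 ?sqr_ge0 ?expR_ge0.
- have -> : expR (- (lam R n * (x * 2))) = expR (- (lam R n * x)) ^+ 2.
    by rewrite -expRM_natl; congr expR; ring.
  by have := expR_ge0 (- (lam R n * x)); have := cmod_ge0 (a n); nra.
Qed.

End upper_bounds.

(** * Lower bounds from series of blocks *)

Section lower_bound.
Variable R : realType.

Definition block_coef (c : nat -> R) (P : nat -> {poly R}) (n : nat) : R[i] :=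
  let k := trunc_log 2 n.+1 in (c k * (P k)`_(n.+1 - 2 ^ k))%:C%C.

Lemma block_coefE c P k j : (j < 2 ^ k)%N ->
  block_coef c P ((2 ^ k).-1 + j) = (c k * (P k)`_j)%:C%C.
Proof.
move=> jk; rewrite /block_coef trunc_log_block//.
by rewrite -addSn prednK ?expn_gt0// addKn.
Qed.

Lemma cvgn_gap (S : nat -> R) (e : R) : cvgn S -> 0 < e ->
  exists N, forall m n, (N <= m)%N -> (N <= n)%N -> S n - S m < e.
Proof.
move=> /cvg_ex[l /cvgrPdist_lt Sl] e0.
have /Sl[N _ h] : 0 < e / 2 by rewrite divr_gt0.
exists N => m n Nm Nn; have := h m Nm; have := h n Nn; rewrite /= !ltr_norml.
by move=> /andP[h1 h2] /andP[h3 h4]; lra.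
Qed.

(* With weights [c k = r ^- k], [r = expR (L - x)], every block contributes at
   least [expR (- x) / 2] to the series at the point [x < L]. *)
Lemma sigma_H_ge (p : \bar R) (L : R) (P : nat -> {poly R}) : 0 < L ->
  (forall k j, 0 <= (P k)`_j) -> (forall k, (size (P k) <= 2 ^ k)%N) ->
  (forall k, expR (k%:R * L) / 2 <= (P k).[1]) ->
  (forall c : nat -> R, (forall k, 0 < c k) -> cvgn (series c) ->
    Hp (lam R) p (block_coef c P)) ->
  (L%:E <= sigma_H (lam R) p)%E.
Proof.
move=> L0 P0 sP P1 HP; apply: le_ereal_inf_tmp => _ [sg hsg <-].
rewrite lee_fin leNgt; apply/negP => sgL.
(* The cut at 0 makes [x] nonnegative, so that [expR (- (lam n * x))] does not increase with the
   frequency. *)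
pose m := Num.max sg 0; have mL : m < L by rewrite gt_max sgL L0.
pose x := (m + L) / 2.
have m0 : 0 <= m by rewrite le_max lexx orbT.
have x0 : 0 <= x by rewrite /x; lra.
have xL : x < L by rewrite /x; lra.
have sgx : sg < x.
  by apply: (@le_lt_trans _ _ m); [rewrite le_max lexx|rewrite /x; lra].
pose q := expR (- (L - x)).
have q0 : 0 < q by exact: expR_gt0.
have q1 : q < 1 by rewrite expR_lt1 oppr_lt0 subr_gt0.
pose c k := q ^+ k.
have c0 k : 0 < c k by rewrite exprn_gt0.
have cc : cvgn (series c).
  have := @is_cvg_geometric_series R 1 q; rewrite ger0_norm ?(ltW q0)//.
  move=> /(_ q1); rewrite (_ : geometric 1 q = c)//.
  by apply/funext => k; rewrite /geometric/= mul1r.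
pose a := block_coef c P.
have : (sigma_c (lam R) a < x%:E)%E.
  by apply: le_lt_trans (hsg a (HP c c0 cc)) _; rewrite lte_fin.
move=> /ereal_inf_lt[_ [th hth <-]]; rewrite lte_fin => thx.
have /dirichlet_cvg_real cS : dirichlet_cvg (lam R) a x%:C%C by exact: hth.
have e0 : 0 < expR (- x) / 2 by rewrite divr_gt0 ?expR_gt0.
have [N hN] := cvgn_gap cS e0.
have pow_ge k : (N <= k)%N -> (N <= (2 ^ k).-1)%N.
  move=> Nk; rewrite -ltnS prednK ?expn_gt0//.
  by apply: (leq_ltn_trans Nk); exact: ltn_expl.
(* These two partial sums differ by exactly block [N]. *)
have := hN _ _ (pow_ge N (leqnn N)) (pow_ge N.+1 (leqnSn N)).
rewrite /series/= !sum_blocks (big_nat_recr N)// addrAC subrr add0r.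
rewrite ltNge => /negP; apply.
(* All frequencies of block [N] are at most [N + 1] and all coefficients are nonnegative, so the
   exponential factor may be made constant. *)
apply: (@le_trans _ _ (\sum_(0 <= j < 2 ^ N)
    c N * (P N)`_j * expR (- ((N%:R + 1) * x)))).
  rewrite -mulr_suml -mulr_sumr.
  have -> : \sum_(0 <= j < 2 ^ N) (P N)`_j = (P N).[1].
    rewrite (horner_coef_wide _ (sP N)) big_mkord.
    by apply: eq_bigr => j _; rewrite expr1n mulr1.
  have -> : expR (- x) / 2 =
      c N * (expR (N%:R * L) / 2) * expR (- ((N%:R + 1) * x)).
    rewrite /c /q -expRM_natl.
    rewrite [RHS](_ : _ = expR (N%:R * - (L - x)) * expR (N%:R * L) *
      expR (- ((N%:R + 1) * x)) / 2); last by ring.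
    by rewrite -!expRD; congr (expR _ / 2); ring.
  apply: ler_wpM2r; first exact: expR_ge0.
  by apply: ler_wpM2l; [exact/ltW|exact: P1].
apply: ler_sum_nat => j /andP[_ jN].
rewrite trunc_log_block// -addSn prednK ?expn_gt0// addKn.
apply: ler_wpM2l; first by rewrite mulr_ge0// ltW.
rewrite ler_expR lerN2; apply: ler_wpM2r => //.
by have /andP[] := @lam_block_bounds R N j jN.
Qed.

End lower_bound.

Section dirichlet_kernel.
Variable R : realType.

(** The scalar is $2^{-m/2}$, written with [expR] to combine with the weights $e^{-k(L-x)}$. The
    polynomial will be evaluated at a character. *)
Definition dirichlet_kernel (m : nat) : {poly R} :=
  expR (- (m%:R * (ln 2 / 2))) *: \poly_(j < 2 ^ m) 1.

Lemma expR_ln2 (m : nat) : expR (m%:R * ln 2) = (2 ^ m)%:R :> R.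
Proof. by rewrite expRM_natl lnK ?posrE// natrX. Qed.

Lemma coef_dirichlet_kernel m j : (dirichlet_kernel m)`_j =
  if (j < 2 ^ m)%N then expR (- (m%:R * (ln 2 / 2))) else 0.
Proof. by rewrite coefZ coef_poly; case: ifP; rewrite ?mulr1 ?mulr0. Qed.

Lemma coef_dirichlet_kernel_ge0 m j : 0 <= (dirichlet_kernel m)`_j.
Proof. by rewrite coef_dirichlet_kernel; case: ifP => // _; exact: expR_ge0. Qed.

Lemma size_dirichlet_kernel m : (size (dirichlet_kernel m) <= 2 ^ m)%N.
Proof. exact: leq_trans (size_scale_leq _ _) (size_poly _ _). Qed.

Lemma dirichlet_kernel_at1 m : (dirichlet_kernel m).[1] = expR (m%:R * (ln 2 / 2)).
Proof.
rewrite hornerZ horner_poly; under eq_bigr do rewrite expr1n mulr1.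
by rewrite sumr_const card_ord -expR_ln2 -expRD; congr expR; field.
Qed.

Lemma sum_sqr_dirichlet_kernel m :
  \sum_(0 <= j < 2 ^ m) (dirichlet_kernel m)`_j ^+ 2 = 1.
Proof.
rewrite big_mkord; under eq_bigr => j _ do
  rewrite coef_dirichlet_kernel ltn_ord -expRM_natl.
rewrite sumr_const card_ord -[_ *+ (2 ^ m)]mulr_natr -expR_ln2 -expRD.
by rewrite -[RHS]expR0; congr expR; field.
Qed.

(** The degree is at most $2(2^{k-1}-1)=2^k-2$ for positive [k]; for [k = 0] the predecessor is
    again 0 and the kernel is constant. *)
Lemma size_dirichlet_kernel_sqr k :
  (size (dirichlet_kernel k.-1 ^+ 2) <= 2 ^ k)%N.
Proof.
rewrite (leq_trans (size_poly_exp_leq _ _))//.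
have := size_dirichlet_kernel k.-1; case: (size _) => [|s] /=.
  by rewrite expn_gt0.
case: k => [|k] /=; first by rewrite expn0 ltnS leqn0 => /eqP ->.
by rewrite expnS mulnC ltn_mul2l.
Qed.

End dirichlet_kernel.

Lemma integral_cmod_le1 d (T : measurableType d) (R : realType)
    (mu : probability T R) (u : T -> R[i]) : cmeasurable u ->
  (\int[mu]_x (cmod (u x) ^+ 2)%:E <= 1)%E ->
  (\int[mu]_x (cmod (u x))%:E <= 1)%E.
Proof.
move=> mu_ u2; have mc := measurable_cmod mu_.
have mc2 : measurable_fun setT (fun x => (cmod (u x) ^+ 2)%:E).
  exact/measurable_EFinP/measurable_funX.
apply: (@le_trans _ _ (\int[mu]_x (2^-1%:E * (1 + (cmod (u x) ^+ 2)%:E)))%E).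
  apply: ge0_le_integral => //.
  - by move=> x _; rewrite lee_fin cmod_ge0.
  - exact/measurable_EFinP.
  - by apply: measurable_funeM; exact: emeasurable_funD.
  - move=> x _; rewrite -EFinD -EFinM lee_fin.
    by have := sqr_ge0 (cmod (u x) - 1); lra.
rewrite ge0_integralZl//; last 2 first.
- exact: emeasurable_funD.
- by move=> x _; rewrite adde_ge0// lee_fin sqr_ge0.
rewrite ge0_integralD//; last by move=> x _; rewrite lee_fin sqr_ge0.
rewrite integral_cst//= (_ : mu setT = 1%E) ?mule1; last exact: probability_setT.
apply: (@le_trans _ _ (2^-1%:E * (1 + 1))%E).
  by apply: lee_wpmul2l; [rewrite lee_fin invr_ge0|rewrite leeD2l].
by rewrite -EFinD -EFinM lee_fin; lra.
Qed.

Section block_polynomials.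
Variable R : realType.
Notation mu := (torus_measure R).
Notation flow := (@flow R).
Variables psi phi : nat -> torus R -> R[i].
Hypothesis hpsi : forall k, is_h flow k%:R (psi k).
Hypothesis hphi : forall k, is_h flow (step R ^+ k) (phi k).

Let hmu := torus_measure_haar R.

Definition block_char k j (x : torus R) : R[i] := psi k x * phi k x ^+ j.

(** The factor [psi k] shifts the frequencies to block [k] without changing the modulus. As the rest
    is an evaluation, squaring [P] squares the modulus of the block. *)
Definition block_poly (P : {poly R}) k (x : torus R) : R[i] :=
  psi k x * (map_poly (real_complex R) P).[phi k x].

Lemma is_h_block_char k j : (j < 2 ^ k)%N ->
  is_h flow (lam R ((2 ^ k).-1 + j)) (block_char k j).
Proof. by move=> jk; rewrite lam_block//; apply: is_hM => //; exact: is_hX. Qed.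

Lemma block_char_character k j : is_character (block_char k j).
Proof. exact: characterM (hpsi k).1 (characterX j (hphi k).1). Qed.

Lemma block_polyE (P : {poly R}) k N x : (size P <= N)%N ->
  block_poly P k x = \sum_(0 <= j < N) (P`_j)%:C%C * block_char k j x.
Proof.
move=> sP; rewrite /block_poly (@horner_coef_wide _ N) ?size_map_poly//.
rewrite big_mkord mulr_sumr; apply: eq_bigr => j _.
by rewrite coef_map mulrCA.
Qed.

Lemma cmod_block_poly P k x :
  cmod (block_poly P k x) = cmod ((map_poly (real_complex R) P).[phi k x]).
Proof. by rewrite cmodM (cmod_character x (hpsi k).1) mul1r. Qed.

Lemma block_poly_cmeasurable P k : cmeasurable (block_poly P k : borel (torus R) -> R[i]).
Proof.
have e : block_poly P k =
    (fun x => \sum_(0 <= j < size P) (P`_j)%:C%C * block_char k j x).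
  by apply/funext => x; exact: block_polyE.
rewrite e; apply: (@cintegrable_cmeasurable _ _ _ mu).
have [] // := @cintegral_sum _ _ _ mu
  (fun j x => (P`_j)%:C%C * block_char k j x) (size P).
move=> j; have ic := cintegrable_character mu (block_char_character k j).
by have [] := cintegralZ (P`_j)%:C%C ic.
Qed.

Lemma block_char_inj k : injective (block_char k).
Proof.
move=> i j e.
have hi : is_h flow (k%:R + i%:R * step R ^+ k) (block_char k i).
  by apply: is_hM => //; exact: is_hX.
have hj : is_h flow (k%:R + j%:R * step R ^+ k) (block_char k j).
  by apply: is_hM => //; exact: is_hX.
rewrite -e in hj; have /addrI/mulIf := is_h_inj hi hj.
rewrite gt_eqF ?exprn_gt0 ?step_gt0// => /(_ isT)/eqP.
by rewrite eqr_nat => /eqP.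
Qed.

Lemma parseval_block_poly (P : {poly R}) k N : (size P <= N)%N ->
  \sum_(0 <= j < N) P`_j ^+ 2 = 1 ->
  (\int[mu]_x (cmod (block_poly P k (x : borel (torus R))) ^+ 2)%:E = 1)%E.
Proof.
move=> sP P1.
have := cintegral_sqr_trig_poly hmu (fun j => (P`_j)%:C%C) N
  (block_char_character k) (@block_char_inj k).
under [X in _ = X -> _]eq_bigr do rewrite cmod_real real_normK ?num_real//.
rewrite P1 /Rintegral.
under eq_integral do rewrite -(block_polyE _ _ sP).
(* [fine] sends infinite values to 0, so the value 1 rules them out. *)
by case: (integral _ _ _) => [r| |] //= => [->|/eqP|/eqP];
  rewrite // eq_sym oner_eq0.
Qed.

Variables (c : nat -> R) (P : nat -> {poly R}).
Hypothesis c0 : forall k, 0 < c k.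
Hypothesis cc : cvgn (series c).
Hypothesis sP : forall k, (size (P k) <= 2 ^ k)%N.
Hypothesis P1 : forall k,
  (\int[mu]_x (cmod (block_poly (P k) k (x : borel (torus R))))%:E <= 1)%E.

Lemma fourier_block_poly k chi : is_character chi ->
  fourier mu (block_poly (P k) k) chi =
  \sum_(0 <= j < 2 ^ k) ((P k)`_j)%:C%C * (`[< block_char k j = chi >])%:R.
Proof.
move=> hc; rewrite -(fourier_trig_poly hmu _ _ hc (block_char_character k)).
by congr (fourier mu _ chi); apply/funext => x; exact: block_polyE.
Qed.

(** Characters outside the frequency are orthogonal to every block, and each [block_char] occurs in
    one block only; this identifies all Fourier coefficients of the sum. *)
Lemma torus_series : exists f : torus R -> R[i],
  [/\ cmeasurable (f : borel (torus R) -> R[i]),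
      (\int[mu]_x (cmod (f (x : borel (torus R))))%:E < +oo)%E,
      (forall chi, is_character chi -> (forall n, ~ is_h flow (lam R n) chi) ->
        fourier mu f chi = 0),
      (forall n chi, is_h flow (lam R n) chi ->
        block_coef c P n = fourier mu f chi) &
      (forall k,
        \int[mu]_x (cmod (block_poly (P k) k (x : borel (torus R))) ^+ 2)%:E <= 1)%E ->
      (\int[mu]_x (cmod (f (x : borel (torus R))) ^+ 2)%:E < +oo)%E].
Proof.
have [f [mf f1 hf f2]] := complex_sum_L1
  (fun k => block_poly_cmeasurable (P k) k) c0 cc P1.
have key chi z : is_character chi ->
    (\forall n \near \oo, \sum_(0 <= k < n)
      (c k)%:C%C * fourier mu (block_poly (P k) k) chi = z) ->
    fourier mu f chi = z.
  move=> hc; apply: hf.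
    exact/continuous_cmeasurable/character_continuous/characterJ.
  by move=> x; rewrite cmodJ cmod_character.
exists f; split => // [chi hc nh|n chi hchi].
  apply: key => //; apply: nearW => n; rewrite big_nat_cond big1// => k _.
  rewrite fourier_block_poly// big_nat_cond big1 ?mulr0// => j.
  rewrite andbT => /andP[_ jk]; rewrite asboolF ?mulr0// => e.
  by apply: (nh ((2 ^ k).-1 + j)%N); rewrite -e; exact: is_h_block_char.
have [k0 [j0 [jk0 en]]] := block_decomp n; rewrite {n}en in hchi *.
have hc := hchi.1.
have -> : chi = block_char k0 j0.
  exact: is_h_unique (@flow_dense R) hchi (is_h_block_char jk0).
have h0 := is_h_block_char jk0; have hc0 := block_char_character k0 j0.
(* Equal characters have equal frequencies, and injectivity of [lam] recovers the block and the
   position. *)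
have other k j : (j < 2 ^ k)%N -> block_char k j = block_char k0 j0 ->
    k = k0 /\ j = j0.
  move=> jk e; have h := is_h_block_char jk; rewrite e in h.
  have /lam_inj e' := is_h_inj h h0.
  have ek : k = k0 by rewrite -(trunc_log_block jk) e' trunc_log_block.
  by split => //; move: e'; rewrite ek => /addnI.
rewrite block_coefE//; apply/esym/key => //.
near=> n; have k0n : (k0 < n)%N by near: n; exact: nbhs_infty_gt.
rewrite (bigD1_seq k0) ?mem_index_iota ?iota_uniq//=.
rewrite big1_seq ?addr0 => [|k /andP[kk0 _]]; last first.
  rewrite fourier_block_poly// big_nat_cond big1 ?mulr0// => j.
  rewrite andbT => /andP[_ jk]; rewrite asboolF ?mulr0// => /(other _ _ jk)[ek _].
  by rewrite ek eqxx in kk0.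
rewrite fourier_block_poly// (bigD1_seq j0) ?mem_index_iota ?iota_uniq//=.
rewrite asboolT// mulr1 big_nat_cond big1 ?addr0 => [|j].
  by rewrite -rmorphM.
move=> /andP[/andP[_ jk] jj0]; rewrite asboolF ?mulr0// => /(other _ _ jk)[_ ej].
by rewrite ej eqxx in jj0.
Unshelve. all: by end_near. Qed.

End block_polynomials.

Section sigma_H_values.
Variable R : realType.
Notation mu := (torus_measure R).

Lemma sigma_H1 : sigma_H (lam R) 1%:E = (ln 2)%:E.
Proof.
apply/eqP; rewrite eq_le; apply/andP; split.
  by apply: ereal_inf_lbound; exists (ln 2) => // a; exact: sigma_c_H1_le.
have [psi hpsi] := choice (fun k => is_h_lattice (lattice_int R (Posz k))).
have [phi hphi] := choice (fun k => is_h_lattice (lattice_stepX R k)).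
pose P k := dirichlet_kernel R k.-1 ^+ 2.
apply: (@sigma_H_ge R _ _ P).
- by rewrite ln_gt0// ltr1n.
- move=> k j; rewrite /P expr2 coefM; apply: sumr_ge0 => i _.
  by rewrite mulr_ge0 ?coef_dirichlet_kernel_ge0.
- exact: size_dirichlet_kernel_sqr.
(* The value at 1 is $2^{k-1}$ for positive [k]; the factor 1/2 allowed in [sigma_H_ge] absorbs the
   shift of index. *)
- move=> k; rewrite /P horner_exp dirichlet_kernel_at1 -expRM_natl.
  have -> : 2%:R * (k.-1%:R * (ln 2 / 2)) = k.-1%:R * ln 2 :> R by field.
  rewrite !expR_ln2 ler_pdivrMr// -natrM ler_nat mulnC -expnS.
  by rewrite leq_exp2l//; case: k.
move=> c c0 cc.
have P1 k : (\int[mu]_x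
    (cmod (block_poly psi phi (P k) k (x : borel (torus R))))%:E <= 1)%E.
  (* Parseval is applied to the kernel of index [k.-1] along the progression of block [k]: its
     squared modulus is the modulus of the squared block. *)
  rewrite -(parseval_block_poly hpsi hphi k (size_dirichlet_kernel R k.-1)
    (sum_sqr_dirichlet_kernel R k.-1)).
  rewrite le_eqVlt; apply/orP; left; apply/eqP.
  apply: eq_integral => x _; rewrite !(@cmod_block_poly _ psi phi hpsi) /P rmorphXn hornerE.
  by rewrite expr2 cmodM -expr2.
have [f [mf f1 nf cf _]] :=
  torus_series hpsi hphi c0 cc (@size_dirichlet_kernel_sqr R) P1.
exists (torus R), (@flow R), mu, f; split => //.
- exact: torus_dirichlet_group.
- exact: torus_measure_haar.
- by split => //; apply/in_Lp1P.
Qed.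

Lemma sigma_H2 : sigma_H (lam R) 2%:E = (ln 2 / 2)%:E.
Proof.
apply/eqP; rewrite eq_le; apply/andP; split.
  by apply: ereal_inf_lbound; exists (ln 2 / 2) => // a; exact: sigma_c_H2_le.
have [psi hpsi] := choice (fun k => is_h_lattice (lattice_int R (Posz k))).
have [phi hphi] := choice (fun k => is_h_lattice (lattice_stepX R k)).
apply: (@sigma_H_ge R _ _ (dirichlet_kernel R)).
- by rewrite divr_gt0// ln_gt0// ltr1n.
- exact: coef_dirichlet_kernel_ge0.
- exact: size_dirichlet_kernel.
- move=> k; rewrite dirichlet_kernel_at1.
  by rewrite ler_pdivrMr// ler_peMr ?expR_ge0// ler1n.
move=> c c0 cc.
have P2 k : (\int[mu]_x (cmod (block_poly psi phi (dirichlet_kernel R k) k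
    (x : borel (torus R))) ^+ 2)%:E <= 1)%E.
  by rewrite (parseval_block_poly hpsi hphi k (size_dirichlet_kernel R k)
    (sum_sqr_dirichlet_kernel R k)).
have P1 k := integral_cmod_le1
  (block_poly_cmeasurable hpsi hphi (dirichlet_kernel R k) k) (P2 k).
have [f [mf f1 nf cf f2]] :=
  torus_series hpsi hphi c0 cc (@size_dirichlet_kernel R) P1.
exists (torus R), (@flow R), mu, f; split => //.
- exact: torus_dirichlet_group.
- exact: torus_measure_haar.
- by split => //; apply/in_Lp2P; split => //; exact: f2.
Qed.

End sigma_H_values.

Theorem theorem5p2 (R : realType) :
  exists lam : nat -> R,
    [/\ is_frequency lam,
        cond_BC lam,
        sigma_H lam 1%:E = (2%:E * sigma_H lam 2%:E)%E
      & (0 < sigma_H lam 2%:E)%E].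
Proof.
exists (lam R); split; [exact: lam_frequency|exact: lam_BC| |].
  by rewrite sigma_H1 sigma_H2 -EFinM; congr _%:E; field.
by rewrite sigma_H2 lte_fin divr_gt0// ln_gt0// ltr1n.
Qed.
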